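(* Let $G$ be a finite simple graph with vertex set $V(G)=\{t_1,\ldots,t_s\}$, let $S=K[t_1,\ldots,t_s]$ be a polynomial ring over a field $K$, and let $I(G)\subset S$ be the edge ideal of $G$. If $\beta_0(G)=2$, then $I(G)^{(2)}$ is Cohen--Macaulay if and only if $G$ is edge-critical.
   Context: The edge ideal $I(G)$ is the ideal of $S$ generated by all $t_it_j$ with $\{t_i,t_j\}\in E(G)$ (it is $(0)$ if $G$ has no edges). For a squarefree monomial ideal $I$ with associated primes $\mathfrak{p}_1,\ldots,\mathfrak{p}_r$ (of $S/I$), the $n$-th symbolic power is $I^{(n)}=\bigcap_{i=1}^r\mathfrak{p}_i^n$. A graded ideal $J\subset S$ is called Cohen--Macaulay if $S/J$ is a Cohen--Macaulay ring. The independence number $\beta_0(G)$ is the largest cardinality of a stable set (a set of pairwise non-adjacent vertices). An edge $e$ of $G$ is critical if $\beta_0(G\setminus e)>\beta_0(G)$, where $G\setminus e$ is obtained from $G$ by removing the edge $e$ and keeping all vertices. $G$ is edge-critical if all its edges are critical. *)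

(* Defs.v *)
From HB Require Import structures.
From mathcomp Require Import all_boot all_order all_algebra.
From mathcomp Require Import generic_quotient ring_quotient.
From mathcomp Require Import boolp classical_sets.
From mathcomp Require Import mpoly.
From mathcomp Require Import ring.

Set Implicit Arguments.
Unset Strict Implicit.
Unset Printing Implicit Defensive.

Import GRing.Theory.

Local Open Scope classical_set_scope.
Local Open Scope ring_scope.
Local Open Scope quotient_scope.

(* Unlike [idealr], ideals here are arbitrary [Prop]-valued sets and may be
   the whole ring, so that generated ideals, powers and intersections are
   total operations. *)
Record ideal (R : comPzRingType) := Ideal {
  ideal_set : R -> Prop;
  ideal_has0 : ideal_set 0;
  ideal_closedD : forall x y, ideal_set x -> ideal_set y -> ideal_set (x + y);
  ideal_closedM : forall a x, ideal_set x -> ideal_set (a * x)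
}.

Coercion ideal_set : ideal >-> Funclass.

Section IdealOperations.
Variable R : comPzRingType.
Implicit Types (I J P : ideal R) (A : set R).

#[local] Obligation Tactic := idtac.

Program Definition ideal_gen A : ideal R :=
  @Ideal R [set x | forall I, A `<=` I -> I x] _ _ _.
Next Obligation. by move=> A I _; exact: (ideal_has0 I). Qed.
Next Obligation.
by move=> A x y hx hy I AI; apply: ideal_closedD; [exact: hx | exact: hy].
Qed.
Next Obligation. by move=> A a x hx I AI; apply: ideal_closedM; exact: hx. Qed.

Program Definition ideal_bigcap (D : set (ideal R)) (F : ideal R -> ideal R) :
  ideal R := @Ideal R (\bigcap_(P in D) F P) _ _ _.
Next Obligation. by move=> D F P _; exact: ideal_has0. Qed.
Next Obligation.
by move=> D F x y hx hy P DP; apply: ideal_closedD; [exact: hx | exact: hy].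
Qed.
Next Obligation. by move=> D F a x hx P DP; apply: ideal_closedM; exact: hx. Qed.

(* The zeroth power is the unit ideal (empty product). *)
Definition ideal_pow I (n : nat) : ideal R :=
  ideal_gen [set x | exists2 f : 'I_n -> R,
    (forall i, I (f i)) & x = \prod_(i < n) f i].

Definition prime_ideal P : Prop :=
  ~ P 1 /\ forall x y, P (x * y) -> P x \/ P y.

Definition maximal_ideal P : Prop :=
  ~ P 1 /\ forall I, P `<=` I -> ~ I 1 -> I `<=` P.

Lemma maximal_ideal_prime P : maximal_ideal P -> prime_ideal P.
Proof.
move=> [P1 maxP]; split=> // x y Pxy.
have [Px|nPx] := pselect (P x); [by left | right].
pose Q := ideal_gen (P `|` [set x]).
have PQ : P `<=` Q by move=> z Pz I; apply; left.
have Qx : Q x by move=> I; apply; right.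
have [Q1|nQ1] := pselect (Q 1); last by case: nPx; exact: (maxP Q).
pose C : set R := [set z | P (z * y)].
have C0 : C 0 by rewrite /C /= mul0r; exact: ideal_has0.
have CD u v : C u -> C v -> C (u + v).
  by rewrite /C /= mulrDl; exact: ideal_closedD.
have CM a u : C u -> C (a * u).
  by rewrite /C /= -mulrA; exact: ideal_closedM.
have := Q1 (Ideal C0 CD CM); rewrite /= /C /= mul1r; apply => z [Pz|->] //=.
by rewrite mulrC; exact: ideal_closedM.
Qed.

(* The annihilator of the class of [f] in [R / I] is the colon ideal [I : f]. *)
Definition associated_prime I : set (ideal R) :=
  [set P | prime_ideal P /\ exists f, forall g, P g <-> I (g * f)].

(* This is the n-th symbolic power when [I] is radical, in particular for
   squarefree monomial ideals. *)
Definition symbolic_power I (n : nat) : ideal R :=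
  ideal_bigcap (associated_prime I) (fun P => ideal_pow P n).

End IdealOperations.

Section QuotientRing.
Variables (R : comPzRingType) (I : ideal R).

Definition ideal_pred : {pred R} := fun x => `[< I x >].

Lemma ideal_pred_zmod_closed : zmod_closed ideal_pred.
Proof.
split=> [|x y /asboolP Ix /asboolP Iy]; apply/asboolP; first exact: ideal_has0.
by apply: ideal_closedD => //; rewrite -mulN1r; exact: ideal_closedM.
Qed.

HB.instance Definition _ :=
  GRing.isZmodClosed.Build R ideal_pred ideal_pred_zmod_closed.

(* [{ideal_quot _}] is a ring only for proper ideals; the unit ideal is
   allowed here, hence the possibly trivial ring structure. *)
Definition quotient : Type := @Quotient.quot R ideal_pred.
HB.instance Definition _ := GRing.Zmodule.on quotient.
HB.instance Definition _ :=
  EqQuotient.copy quotient (@Quotient.quot R ideal_pred).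

Lemma quotient_eqP (x y : R) : \pi_quotient x = \pi_quotient y <-> I (x - y).
Proof.
split=> [/eqP|Ixy]; first by rewrite -Quotient.idealrBE => /asboolP.
by apply/eqP; rewrite -Quotient.idealrBE; apply/asboolP.
Qed.

Lemma quotient_piD (x y : R) :
  \pi_quotient (x + y) = \pi_quotient x + \pi_quotient y.
Proof. exact: Quotient.pi_add. Qed.

Definition quotient_one : quotient := \pi_quotient 1.
Definition quotient_mul (x y : quotient) : quotient :=
  \pi_quotient (repr x * repr y).

Lemma quotient_piM (x y : R) :
  \pi_quotient (x * y) = quotient_mul (\pi_quotient x) (\pi_quotient y).
Proof.
apply/quotient_eqP; set x' := repr _; set y' := repr _.
have Ix : I (x - x') by apply/quotient_eqP; rewrite reprK.
have Iy : I (y - y') by apply/quotient_eqP; rewrite reprK.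
have -> : x * y - x' * y' = y * (x - x') + x' * (y - y') by ring.
by apply: ideal_closedD; exact: ideal_closedM.
Qed.

Lemma quotientW (Q : quotient -> Prop) :
  (forall a, Q (\pi_quotient a)) -> forall x, Q x.
Proof. by move=> h x; rewrite -[x]reprK; exact: h. Qed.

Let mulA : associative quotient_mul.
Proof.
elim/quotientW=> a; elim/quotientW=> b; elim/quotientW=> c.
by rewrite -!quotient_piM mulrA.
Qed.
Let mulC : commutative quotient_mul.
Proof. by move=> x y; rewrite /quotient_mul mulrC. Qed.
Let mul1 : left_id quotient_one quotient_mul.
Proof. by elim/quotientW=> a; rewrite -quotient_piM mul1r. Qed.
Let mulDl : left_distributive quotient_mul +%R.
Proof.
elim/quotientW=> a; elim/quotientW=> b; elim/quotientW=> c.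
by rewrite -!quotient_piM -!quotient_piD -quotient_piM mulrDl.
Qed.

HB.instance Definition _ :=
  GRing.Zmodule_isComPzRing.Build quotient mulA mulC mul1 mulDl.

End QuotientRing.

Section Localization.
Variables (R : comPzRingType) (P : ideal R) (primeP : prime_ideal P).

Definition denominator := {s : R | `[< ~ P s >]}.
Definition fraction_data := (R * denominator)%type.

Lemma denominatorP (s : denominator) : ~ P (val s).
Proof. exact/asboolP/(valP s). Qed.

Lemma denominator1_subproof : `[< ~ P 1 >].
Proof. by apply/asboolP; case: primeP. Qed.

Lemma denominatorM_subproof (s t : denominator) : `[< ~ P (val s * val t) >].
Proof.
apply/asboolP => Pst; case: primeP => _ /(_ _ _ Pst).
by case; exact: denominatorP.
Qed.

Definition denominator1 : denominator := exist _ 1 denominator1_subproof.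
Definition denominatorM (s t : denominator) : denominator :=
  exist _ (val s * val t) (denominatorM_subproof s t).

Definition fraction_equiv (x y : fraction_data) : bool :=
  `[< exists s : denominator, val s * (x.1 * val y.2 - y.1 * val x.2) = 0 >].

Lemma fraction_equiv_is_equiv : equiv_class_of fraction_equiv.
Proof.
split=> [x|x y|y x z].
- by apply/asboolP; exists denominator1; rewrite subrr mulr0.
- by apply/asboolP/asboolP => -[s hs]; exists s;
    rewrite -opprB mulrN hs oppr0.
- move=> /asboolP [s hs] /asboolP [t ht]; apply/asboolP.
  exists (denominatorM (denominatorM s t) y.2); rewrite /=.
  have -> : val s * val t * val y.2 * (x.1 * val z.2 - z.1 * val x.2) =
    val t * val z.2 * (val s * (x.1 * val y.2 - y.1 * val x.2)) +
    val s * val x.2 * (val t * (y.1 * val z.2 - z.1 * val y.2)) by ring.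
  by rewrite hs ht !mulr0 addr0.
Qed.

Canonical fraction_equiv_equiv := EquivRelPack fraction_equiv_is_equiv.
Canonical fraction_equiv_encModRel := defaultEncModRel fraction_equiv.

Definition localization : Type := {eq_quot fraction_equiv}.
HB.instance Definition _ := Choice.on localization.
HB.instance Definition _ : EqQuotient fraction_data fraction_equiv localization
  := EqQuotient.on localization.

Definition frac (a : R) (s : denominator) : localization :=
  \pi_localization ((a, s) : fraction_data).

Lemma frac_eqP a s b t : frac a s = frac b t <->
  exists u : denominator, val u * (a * val t - b * val s) = 0.
Proof.
split=> [/eqmodP/asboolP //|h]; apply/eqmodP; exact/asboolP.
Qed.

Lemma frac_repr (x : localization) : frac (repr x).1 (repr x).2 = x.
Proof. by rewrite /frac -surjective_pairing reprK. Qed.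

Lemma fracW (Q : localization -> Prop) :
  (forall a s, Q (frac a s)) -> forall x, Q x.
Proof. by move=> h x; rewrite -[x]frac_repr; exact: h. Qed.

Definition loc_zero : localization := frac 0 denominator1.
Definition loc_one : localization := frac 1 denominator1.
Definition loc_opp (x : localization) : localization :=
  frac (- (repr x).1) (repr x).2.
Definition loc_add (x y : localization) : localization :=
  frac ((repr x).1 * val (repr y).2 + (repr y).1 * val (repr x).2)
       (denominatorM (repr x).2 (repr y).2).
Definition loc_mul (x y : localization) : localization :=
  frac ((repr x).1 * (repr y).1) (denominatorM (repr x).2 (repr y).2).

Lemma repr_frac a s : exists u : denominator,
  val u * ((repr (frac a s)).1 * val s - a * val (repr (frac a s)).2) = 0.
Proof. by apply/frac_eqP; rewrite frac_repr. Qed.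

Lemma loc_oppE a s : loc_opp (frac a s) = frac (- a) s.
Proof.
apply/frac_eqP; have [u] := repr_frac a s.
case: (repr _) => b t /= hu; exists u.
have -> : val u * (- b * val s - - a * val t) =
  - (val u * (b * val s - a * val t)) by ring.
by rewrite hu oppr0.
Qed.

Lemma loc_addE a s b t :
  loc_add (frac a s) (frac b t) =
  frac (a * val t + b * val s) (denominatorM s t).
Proof.
apply/frac_eqP; have [u] := repr_frac a s; have [v] := repr_frac b t.
case: (repr (frac a s)) (repr (frac b t)) => a' s' [b' t'] /= hv hu.
exists (denominatorM u v) => /=.
have -> : val u * val v *
    ((a' * val t' + b' * val s') * (val s * val t)
     - (a * val t + b * val s) * (val s' * val t')) =
  val v * val t * val t' * (val u * (a' * val s - a * val s')) +
  val u * val s * val s' * (val v * (b' * val t - b * val t')) by ring.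
by rewrite hu hv !mulr0 addr0.
Qed.

Lemma loc_mulE a s b t :
  loc_mul (frac a s) (frac b t) = frac (a * b) (denominatorM s t).
Proof.
apply/frac_eqP; have [u] := repr_frac a s; have [v] := repr_frac b t.
case: (repr (frac a s)) (repr (frac b t)) => a' s' [b' t'] /= hv hu.
exists (denominatorM u v) => /=.
have -> : val u * val v *
    (a' * b' * (val s * val t) - a * b * (val s' * val t')) =
  val v * b' * val t * (val u * (a' * val s - a * val s')) +
  val u * a * val s' * (val v * (b' * val t - b * val t')) by ring.
by rewrite hu hv !mulr0 addr0.
Qed.

Lemma frac_eq a s b t : a * val t = b * val s -> frac a s = frac b t.
Proof.
by move=> h; apply/frac_eqP; exists denominator1; rewrite h subrr mulr0.
Qed.

Let addA : associative loc_add.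
Proof.
elim/fracW=> a s; elim/fracW=> b t; elim/fracW=> c u.
by rewrite !loc_addE; apply: frac_eq => /=; ring.
Qed.
Let addC : commutative loc_add.
Proof.
elim/fracW=> a s; elim/fracW=> b t.
by rewrite !loc_addE; apply: frac_eq => /=; ring.
Qed.
Let add0 : left_id loc_zero loc_add.
Proof. by elim/fracW=> a s; rewrite !loc_addE; apply: frac_eq => /=; ring. Qed.
Let addN : left_inverse loc_zero loc_opp loc_add.
Proof.
elim/fracW=> a s; rewrite loc_oppE loc_addE; apply: frac_eq => /=; ring.
Qed.

HB.instance Definition _ :=
  GRing.isZmodule.Build localization addA addC add0 addN.

Let mulA : associative loc_mul.
Proof.
elim/fracW=> a s; elim/fracW=> b t; elim/fracW=> c u.
by rewrite !loc_mulE; apply: frac_eq => /=; ring.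
Qed.
Let mulC : commutative loc_mul.
Proof.
elim/fracW=> a s; elim/fracW=> b t.
by rewrite !loc_mulE; apply: frac_eq => /=; ring.
Qed.
Let mul1 : left_id loc_one loc_mul.
Proof. by elim/fracW=> a s; rewrite !loc_mulE; apply: frac_eq => /=; ring. Qed.
Let mulDl : left_distributive loc_mul +%R.
Proof.
elim/fracW=> a s; elim/fracW=> b t; elim/fracW=> c u.
have addE a1 s1 a2 s2 : frac a1 s1 + frac a2 s2 =
    frac (a1 * val s2 + a2 * val s1) (denominatorM s1 s2) by exact: loc_addE.
rewrite addE !loc_mulE addE.
by apply: frac_eq => /=; ring.
Qed.

HB.instance Definition _ :=
  GRing.Zmodule_isComPzRing.Build localization mulA mulC mul1 mulDl.

End Localization.

Section CohenMacaulay.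
Implicit Type R : comPzRingType.

Definition noetherian R : Prop :=
  forall I : ideal R, exists xs : seq R,
    ideal_gen [set x | x \in xs] = I :> set R.

Definition prime_chain R (n : nat) (P : nat -> ideal R) : Prop :=
  (forall i, (i <= n)%N -> prime_ideal (P i)) /\
  (forall i, (i < n)%N -> P i `<` P i.+1).

Definition krull_dimension R (d : nat) : Prop :=
  (exists P : nat -> ideal R, prime_chain d P) /\
  (forall n (P : nat -> ideal R), prime_chain n P -> (n <= d)%N).

(* Each [xs`_i] is a nonzerodivisor on [R / (xs`_0, ..., xs`_(i-1))] and
   [R / (xs)] is nonzero. *)
Definition regular_sequence R (xs : seq R) : Prop :=
  (forall i, (i < size xs)%N -> forall a,
     ideal_gen [set x | x \in take i xs] (xs`_i * a) ->
     ideal_gen [set x | x \in take i xs] a) /\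
  ~ ideal_gen [set x | x \in xs] 1.

(* The depth of a local ring with maximal ideal [m]. *)
Definition depth R (m : ideal R) (d : nat) : Prop :=
  (exists xs : seq R,
     [/\ regular_sequence xs, forall x, x \in xs -> m x & size xs = d]) /\
  (forall xs : seq R, regular_sequence xs -> (forall x, x \in xs -> m x) ->
     (size xs <= d)%N).

Definition local_ring R (m : ideal R) : Prop :=
  maximal_ideal m /\
  forall m' : ideal R, maximal_ideal m' -> m' = m :> set R.

Definition cohen_macaulay_local R : Prop :=
  noetherian R /\
  exists m : ideal R, local_ring m /\
  exists d : nat, depth m d /\ krull_dimension R d.

Definition cohen_macaulay R : Prop :=
  noetherian R /\
  forall (m : ideal R) (maxm : maximal_ideal m),
    cohen_macaulay_local (localization (maximal_ideal_prime maxm)).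

Definition cohen_macaulay_ideal R (J : ideal R) : Prop :=
  cohen_macaulay (quotient J).

End CohenMacaulay.

Section Graphs.
Variable s : nat.
Implicit Type e : rel 'I_s.

Definition edge_ideal (K : fieldType) e : ideal {mpoly K[s]} :=
  ideal_gen [set f | exists i j, e i j /\ f = 'X_i * 'X_j].

Definition stable e (A : {set 'I_s}) : bool :=
  [forall i in A, forall j in A, ~~ e i j].

Definition independence_number e : nat :=
  (\max_(A : {set 'I_s} | stable e A) #|A|)%N.

Definition remove_edge e (i j : 'I_s) : rel 'I_s :=
  [rel x y | e x y && ([set x; y] != [set i; j])%SET].

Definition critical_edge e (i j : 'I_s) : Prop :=
  e i j /\ (independence_number e < independence_number (remove_edge e i j))%N.

Definition edge_critical e : Prop :=
  forall i j, e i j -> critical_edge e i j.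

End Graphs.

(* Main.v *)
(* For a maximal stable set F of G let p_F be the prime generated by the
   variables outside F, so that J = I(G)^(2) is the intersection of the p_F^2:
   a monomial lies in J if and only if it has degree at least 2 in the
   variables outside F, for every F.

   If G is edge-critical, the sets F are the edges of the complement H of G, and
   H has diameter at most 2.  For a maximal ideal m containing J there is a
   monic polynomial q with q(0) = 0 and all q(t_k) in m; let f and g be the
   first two elementary symmetric functions of the q(t_k).  Modulo p_F^2,
   F = {u, v}, the sequence (f, g) is regular, since f is a nonzerodivisor and
   g is congruent to q(t_u) q(t_v) up to a multiple of f.  Hence a relation
   g a = f b modulo J gives c_F with a = f c_F modulo p_F^2.  If F and F' share
   a vertex, then f is a nonzerodivisor modulo a monomial ideal containing
   p_F^2 + p_F'^2, so c_F and c_F' have the same coefficient at all monomials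
   outside this ideal; as H has diameter at most 2, the c_F glue to a single c
   with a = f c modulo J.  The dimension of S/J is at most 2 because three
   elements of S are algebraically dependent over K modulo each p_F.

   Conversely, suppose that {i, j} is an edge of G without common neighbour of
   i and j in H, and put z_F = t_i t_j if i is in F and z_F = 0 otherwise.
   Each family (t_k z_F)_F is induced by a polynomial modulo the p_F^2, but
   (z_F)_F is not; as these families embed S/J into a module on which t_u is
   a nonzerodivisor in the component F for u in F, no sequence of length 2 is
   regular in the local ring at the origin, which has dimension at least 2. *)

Require Import Defs.
From HB Require Import structures.
From mathcomp Require Import all_boot all_order all_algebra.
From mathcomp Require Import generic_quotient boolp classical_sets.
From mathcomp Require Import mpoly.
From mathcomp Require Import ring zify.

Set Implicit Arguments.
Unset Strict Implicit.
Unset Printing Implicit Defensive.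

Import GRing.Theory.

(** * Ideals and prime chains *)

Section Ideals.
Local Open Scope ring_scope.
Local Open Scope classical_set_scope.
Variable R : comPzRingType.
Implicit Types (I J P : ideal R) (A : set R).

Lemma ideal_closedN I x : I x -> I (- x).
Proof. by move=> Ix; rewrite -mulN1r; apply: ideal_closedM. Qed.

Lemma ideal_closedB I x y : I x -> I y -> I (x - y).
Proof. by move=> Ix Iy; apply: ideal_closedD => //; apply: ideal_closedN. Qed.

Lemma ideal_closedMr I x a : I x -> I (x * a).
Proof. by move=> Ix; rewrite mulrC; apply: ideal_closedM. Qed.

Lemma ideal_subE I x y : I (x - y) -> I x <-> I y.
Proof.
move=> Ixy; split=> [Ix|Iy]; last by rewrite -(subrK y x); apply: ideal_closedD.
by rewrite -(subKr x y); apply: ideal_closedB.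
Qed.

Lemma ideal_sum I (T : Type) (r : seq T) (Q : pred T) (F : T -> R) :
  (forall i, Q i -> I (F i)) -> I (\sum_(i <- r | Q i) F i).
Proof.
move=> IF; elim/big_rec: _ => [|i x Qi Ix]; first exact: ideal_has0.
by apply: ideal_closedD => //; apply: IF.
Qed.

Lemma ideal_gen_incl A x : A x -> ideal_gen A x.
Proof. by move=> Ax I; apply. Qed.

Lemma ideal_gen_min A I : A `<=` I -> ideal_gen A `<=` I.
Proof. by move=> AI x; apply. Qed.

Lemma ideal_ext I J : I = J :> set R -> I = J.
Proof.
case: I J => [I I0 ID IM] [J J0 JD JM] /= eIJ.
by subst J; congr Ideal; apply: Prop_irrelevance.
Qed.

Lemma prime_ideal_exp P x n : prime_ideal P -> P (x ^+ n) -> P x.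
Proof.
move=> [P1 Pprime]; elim: n => [|n IHn]; first by rewrite expr0.
by rewrite exprS => /Pprime[].
Qed.

Lemma prime_ideal_prod P (T : Type) (r : seq T) (Q : pred T) (F : T -> R) :
  prime_ideal P -> P (\prod_(i <- r | Q i) F i) -> exists2 i, Q i & P (F i).
Proof.
move=> [P1 Pprime]; elim: r => [|i r IHr]; first by rewrite big_nil.
rewrite big_cons; case: ifP => // Qi /Pprime[PFi|//]; by exists i.
Qed.

Section Adjoin.
Variables (I : ideal R) (x : R).
#[local] Obligation Tactic := idtac.

(** The ideal I + (x), in a form where membership hands over the coefficient of [x]. *)
Program Definition ideal_adjoin : ideal R :=
  @Ideal R [set z | exists b, I (z - b * x)] _ _ _.
Next Obligation. by exists 0; rewrite mul0r subr0; apply: ideal_has0. Qed.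
Next Obligation.
move=> y z [b Ib] [c Ic]; exists (b + c).
have -> : y + z - (b + c) * x = (y - b * x) + (z - c * x) by ring.
exact: ideal_closedD.
Qed.
Next Obligation.
move=> a z [b Ib]; exists (a * b).
by rewrite -mulrA -mulrBr; apply: ideal_closedM.
Qed.

Lemma ideal_adjoin_sub : I `<=` ideal_adjoin.
Proof. by move=> z Iz; exists 0; rewrite mul0r subr0. Qed.

Lemma ideal_adjoin_mem : ideal_adjoin x.
Proof. by exists 1; rewrite mul1r subrr; apply: ideal_has0. Qed.

End Adjoin.

Lemma maximal_ideal_inv P x :
  maximal_ideal P -> ~ P x -> exists u, P (u * x - 1).
Proof.
move=> [P1 maxP] Px; have [[u Pu]|nP] := pselect (ideal_adjoin P x 1).
  by exists u; rewrite -opprB; apply: ideal_closedN.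
case: Px; apply: (maxP (ideal_adjoin P x)) => //; last exact: ideal_adjoin_mem.
exact: ideal_adjoin_sub.
Qed.

(** An ideal maximal among those containing [I] and missing the multiplicative set [T] is prime;
    Zorn's lemma provides one. *)
Lemma exists_prime_avoiding I (T : set R) :
  T 1 -> (forall x y, T x -> T y -> T (x * y)) -> (forall x, I x -> ~ T x) ->
  exists P, [/\ prime_ideal P, I `<=` P & forall x, P x -> ~ T x].
Proof.
move=> T1 TM IT.
pose good (A : set R) := exists P, [/\ P = A :> set R, I `<=` P &
  forall x, P x -> ~ T x].
have [|A [[A0|[P [PA IP PT]]] maxA]] :=
    @Zorn_bigcup R (fun A => A = set0 \/ good A).
- move=> F Fgood Ftot.
  have [[A FA A0]|F0] := pselect (exists2 A, F A & A <> set0); last first.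
    left; rewrite -subset0 => x [A FA Ax]; apply: F0; exists A => // A0.
    by rewrite A0 in Ax.
  right; have [//|[P0 [PA IP0 P0T]]] := Fgood A FA.
  have sub B : F B -> B <> set0 -> good B by move=> /Fgood[].
  pose U := \bigcup_(X in F) X.
  have U0 : U 0 by exists A => //; rewrite -PA; apply: ideal_has0.
  have UD x y : U x -> U y -> U (x + y).
    move=> [B FB Bx] [C FC Cy].
    have [BC|CB] := Ftot B C FB FC.
      have [eC|[Q [QC _ _]]] := Fgood C FC; first by rewrite eC in Cy.
      exists C => //; rewrite -QC; apply: ideal_closedD; rewrite QC //.
      exact: BC.
    have [eB|[Q [QB _ _]]] := Fgood B FB; first by rewrite eB in Bx.
    exists B => //; rewrite -QB; apply: ideal_closedD; rewrite QB //.
    exact: CB.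
  have UM a x : U x -> U (a * x).
    move=> [B FB Bx]; have [eB|[Q [QB _ _]]] := Fgood B FB.
      by rewrite eB in Bx.
    by exists B => //; rewrite -QB; apply: ideal_closedM; rewrite QB.
  exists (Ideal U0 UD UM); split=> //.
    by move=> x Ix; exists A => //; rewrite -PA; apply: IP0.
  move=> x [B FB Bx]; have [eB|[Q [QB _ QT]]] := Fgood B FB.
    by rewrite eB in Bx.
  by apply: QT; rewrite QB.
- case: (maxA I); last by right; exists I; split=> //.
  by rewrite A0; split=> [//|/(_ 0 (ideal_has0 I))].
have maxP (Q : ideal R) x : P `<=` Q -> ~ P x -> Q x -> exists2 y, Q y & T y.
  move=> PQ Px Qx; have [[y]|nT] := pselect (exists2 y, Q y & T y).
    by exists y.
  case: (maxA Q); first by rewrite -PA; split=> // QP; apply: Px; apply: QP.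
  right; exists Q; split=> // [y /IP /PQ //|y Qy Ty].
  by apply: nT; exists y.
exists P; split=> //; split=> [P1|x y Pxy]; first exact: PT P1 T1.
have [Px|Px] := pselect (P x); first by left.
have [Py|Py] := pselect (P y); first by right.
have [u [a Pa] Tu] :=
  maxP _ x (@ideal_adjoin_sub P x) Px (ideal_adjoin_mem P x).
have [v [b Pb] Tv] :=
  maxP _ y (@ideal_adjoin_sub P y) Py (ideal_adjoin_mem P y).
case: (PT (u * v)); last exact: TM.
have -> : u * v = (u - a * x) * v + a * x * (v - b * y) + a * b * (x * y).
  by ring.
apply: ideal_closedD; last exact: ideal_closedM.
by apply: ideal_closedD; [apply: ideal_closedMr|apply: ideal_closedM].
Qed.

(* For a nonzerodivisor [x] modulo [I], the set of all [s * x ^+ n] with [s]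
   outside a prime [P] containing [I] avoids [I]: a prime containing [I] and
   avoiding this set lies below [P] and misses [x]. *)
Lemma exists_prime_below I P x :
  prime_ideal P -> I `<=` P -> P x -> (forall a, I (x * a) -> I a) ->
  exists Q, [/\ prime_ideal Q, I `<=` Q & Q `<` P].
Proof.
move=> primeP IP Px regx.
pose T := [set y | exists s n, ~ P s /\ y = s * x ^+ n].
have [||y Iy [s [n [Ps eqy]]]|Q [primeQ IQ QT]] := @exists_prime_avoiding I T.
- by exists 1, 0%N; rewrite mulr1; split=> //; case: primeP.
- move=> _ _ [s [n [Ps ->]]] [t [k [Pt ->]]]; exists (s * t), (n + k)%N.
  split; last by rewrite exprD; ring.
  by case: primeP => _ primeP /primeP[].
- apply: Ps; apply: IP; rewrite {}eqy in Iy; elim: n Iy => [|n IHn].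
    by rewrite mulr1.
  by rewrite exprS mulrCA => /regx.
exists Q; split=> //; split=> [y Qy|PQ].
  have [//|Py] := pselect (P y); case: (QT y Qy).
  by exists y, 0%N; rewrite mulr1.
case: (QT x (PQ _ Px)); exists 1, 1%N; rewrite mul1r expr1; split=> //.
by case: primeP.
Qed.

(** Start with a prime containing the whole sequence and drop its elements from the last to the
    first: each is a nonzerodivisor modulo the ones before it, so [exists_prime_below] adds a
    strictly smaller prime at the bottom. *)
Lemma regular_sequence_chain (xs : seq R) :
  regular_sequence xs -> exists P : nat -> ideal R, prime_chain (size xs) P.
Proof.
move=> [regxs xs1].
suff: forall k, (k <= size xs)%N -> exists P : nat -> ideal R,
    prime_chain k P /\
    ideal_gen [set x | x \in take (size xs - k) xs] `<=` P 0%N.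
  by move=> /(_ _ (leqnn _))[P [chainP _]]; exists P.
elim=> [_|k IHk ltk].
  rewrite subn0 take_size.
  have [||x Ix x1|P [primeP IP _]] :=
      @exists_prime_avoiding (ideal_gen [set x | x \in xs]) [set 1].
  - by [].
  - by move=> x y /= -> ->; rewrite mulr1.
  - by apply: xs1; rewrite -[1]x1.
  by exists (fun=> P).
have [P [[primeP ltP] IP]] := IHk (ltnW ltk).
set i := (size xs - k.+1)%N.
have lti : (i < size xs)%N by rewrite /i; lia.
have ei : (size xs - k)%N = i.+1 by rewrite /i; lia.
rewrite ei (take_nth 0) // in IP.
have [||||Q [primeQ IQ ltQ]] :=
    @exists_prime_below (ideal_gen [set x | x \in take i xs]) (P 0%N) xs`_i.
- exact: primeP.
- apply: subset_trans IP; apply: ideal_gen_min => x /= xi.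
  by apply: ideal_gen_incl; rewrite /= mem_rcons inE xi orbT.
- by apply: IP; apply: ideal_gen_incl; rewrite /= mem_rcons inE eqxx.
- exact: regxs.
exists (fun j => if j is j'.+1 then P j' else Q); split=> //.
by split=> [[|j]|[|j]] //= ltj; [apply: primeP|apply: ltP].
Qed.

Lemma ideal_gen_nil (x : R) :
  ideal_gen [set x | x \in [::]] x <-> x = 0.
Proof.
split=> [|->]; last exact: ideal_has0.
pose Z : ideal R := @Ideal R [set 0] erefl
  (fun x y x0 y0 => etrans (congr2 +%R x0 y0) (addr0 0))
  (fun a x x0 => etrans (congr1 ( *%R a) x0) (mulr0 a)).
by apply: (@ideal_gen_min _ Z).
Qed.

Lemma ideal_gen_seq1 (f x : R) :
  ideal_gen [set x | x \in [:: f]] x <-> exists c, x = c * f.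
Proof.
split=> [|[c ->]]; last first.
  by apply: ideal_closedM; apply: ideal_gen_incl; rewrite /= inE.
move=> gx; have: ideal_adjoin (ideal_gen [set x : R | x \in [::]]) f x.
  apply: ideal_gen_min gx => y /=; rewrite inE => /eqP ->.
  by exists 1; rewrite mul1r subrr => I _; apply: ideal_has0.
move=> [c /ideal_gen_nil/eqP]; rewrite subr_eq0 => /eqP ->; by exists c.
Qed.

Lemma prime_chain_sub0 n (P : nat -> ideal R) i :
  prime_chain n P -> (i <= n)%N -> P 0%N `<=` P i.
Proof.
move=> [_ ltP]; elim: i => [_ //|k IHk] ltk.
by apply: subset_trans (IHk (ltnW ltk)) (ltP k ltk).1.
Qed.

Lemma prime_chain_subn n (P : nat -> ideal R) i :
  prime_chain n P -> (i <= n)%N -> P i `<=` P n.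
Proof.
move=> [_ ltP] lei; rewrite -(subKn lei).
elim: (n - i)%N (leq_subr i n) => [|k IHk] lek; first by rewrite subn0.
have lt : (n - k.+1 < n)%N by lia.
apply: subset_trans (ltP _ lt).1 _.
have -> : (n - k.+1).+1 = (n - k)%N by lia.
by apply: IHk; lia.
Qed.

End Ideals.

(** * Localization and quotients *)

Section LocalizationMap.
Local Open Scope ring_scope.
Local Open Scope classical_set_scope.
Variables (R L : comPzRingType) (lam : {rmorphism R -> L}) (J m : ideal R).

(* [lam] exhibits [L] as the localization of [R / J] at the image of [m]. *)
Definition is_localization : Prop :=
  [/\ forall a, lam a = 0 <-> exists2 s, ~ m s & J (s * a),
      forall s, ~ m s -> exists u, u * lam s = 1 &
      forall x, exists a s, ~ m s /\ lam s * x = lam a].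

Hypotheses (primem : prime_ideal m) (Jm : J `<=` m) (locL : is_localization).

Lemma loc_kerP a : lam a = 0 <-> exists2 s, ~ m s & J (s * a).
Proof. by case: locL. Qed.

Lemma loc_unit s : ~ m s -> exists u, u * lam s = 1.
Proof. by case: locL => _ + _; apply. Qed.

Lemma loc_fracP x : exists a s, ~ m s /\ lam s * x = lam a.
Proof. by case: locL => _ _; apply. Qed.

Lemma notin_primeM s t : ~ m s -> ~ m t -> ~ m (s * t).
Proof. by case: primem => _ pm ms mt /pm[]. Qed.

Lemma loc_mulI s : ~ m s -> injective ( *%R (lam s)).
Proof.
move=> /loc_unit[u us] x y sxy; rewrite -[x]mul1r -[y]mul1r -us -!mulrA.
by rewrite sxy.
Qed.

Lemma loc_eqP a b : lam a = lam b <-> exists2 s, ~ m s & J (s * (a - b)).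
Proof.
rewrite -loc_kerP rmorphB; split=> [->|/eqP]; first by rewrite subrr.
by rewrite subr_eq0 => /eqP.
Qed.

Lemma loc_ker a : J a -> lam a = 0.
Proof.
by move=> Ja; apply/loc_kerP; exists 1; [case: primem|rewrite mul1r].
Qed.

Lemma loc_ideal_unit (Q : ideal L) s x : ~ m s -> Q (lam s * x) -> Q x.
Proof.
move=> /loc_unit[u us] Qsx; rewrite -[x]mul1r -us -mulrA.
exact: ideal_closedM.
Qed.

Section Contraction.
Variable Q : ideal L.
#[local] Obligation Tactic := idtac.

Program Definition contraction : ideal R := @Ideal R [set a | Q (lam a)] _ _ _.
Next Obligation. by rewrite /= rmorph0; apply: ideal_has0. Qed.
Next Obligation. by move=> x y /=; rewrite rmorphD; apply: ideal_closedD. Qed.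
Next Obligation. by move=> a x /=; rewrite rmorphM; apply: ideal_closedM. Qed.

Lemma contraction_ker : J `<=` contraction.
Proof. by move=> a /loc_ker la0; rewrite /= la0; apply: ideal_has0. Qed.

Lemma contraction_prime : prime_ideal Q -> prime_ideal contraction.
Proof.
move=> [Q1 primeQ]; split=> [|x y] /=; first by rewrite rmorph1.
by rewrite rmorphM; apply: primeQ.
Qed.

End Contraction.

(** Up to a unit every element of [L] comes from [R], so an ideal of [L] is determined by its
    contraction. *)
Lemma contraction_proper (Q Q' : ideal L) :
  Q `<` Q' -> contraction Q `<` contraction Q'.
Proof.
move=> [QQ' Q'Q]; split=> [a /QQ' //|sub]; apply: Q'Q => x Q'x.
have [a [s [ms sx]]] := loc_fracP x.
apply: (loc_ideal_unit ms); rewrite sx; apply: (sub a).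
by rewrite /= -sx; apply: ideal_closedM.
Qed.

Lemma loc_noetherian : noetherian R -> noetherian L.
Proof.
move=> noethR I; have [xs exs] := noethR (contraction I).
have xsI x : x \in xs -> contraction I x.
  by move=> x_xs; rewrite -exs; apply: ideal_gen_incl.
exists [seq lam x | x <- xs]; rewrite eqEsubset; split.
  by apply: ideal_gen_min => _ /mapP[x /xsI Ix ->].
move=> x Ix; have [a [s [ms sx]]] := loc_fracP x.
apply: (loc_ideal_unit ms); rewrite sx.
have: ideal_gen [set x | x \in xs] a.
  by rewrite exs /= -sx; apply: ideal_closedM.
apply: (@ideal_gen_min _ _
  (contraction (ideal_gen [set x | x \in [seq lam x | x <- xs]]))).
by move=> y xs_y; apply: ideal_gen_incl; apply/mapP; exists y.
Qed.

Section Extension.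
Variable P : ideal R.
#[local] Obligation Tactic := idtac.

Program Definition extension : ideal L :=
  @Ideal L [set x | exists a s, [/\ P a, ~ m s & lam s * x = lam a]] _ _ _.
Next Obligation.
exists 0, 1; rewrite mulr0 rmorph0; split=> //; first exact: ideal_has0.
by case: primem.
Qed.
Next Obligation.
move=> x y [a [s [Pa ms sx]]] [b [t [Pb mt ty]]].
exists (t * a + s * b), (s * t); split; last 1 first.
- by rewrite rmorphD !rmorphM -sx -ty; ring.
- by apply: ideal_closedD; apply: ideal_closedM.
exact: notin_primeM.
Qed.
Next Obligation.
move=> y x [a [s [Pa ms sx]]]; have [b [t [mt ty]]] := loc_fracP y.
exists (b * a), (t * s); split; last 1 first.
- by rewrite !rmorphM -sx -ty; ring.
- exact: ideal_closedM.
exact: notin_primeM.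
Qed.

Hypotheses (primeP : prime_ideal P) (JP : J `<=` P) (Pm : P `<=` m).

(** Clearing denominators puts a multiple of [a] by elements outside [m] into [P]; these factors are
    outside [P] too, so primality removes them. *)
Lemma extensionE a : extension (lam a) <-> P a.
Proof.
split=> [[b [s [Pb ms]]]|Pa]; last first.
  by exists a, 1; rewrite rmorph1 mul1r; split=> //; case: primem.
rewrite -rmorphM => /loc_eqP[t mt /JP].
rewrite mulrBr => Pt; case: primeP => _ pP.
have {Pt} : P (t * (s * a)).
  by apply/(ideal_subE Pt); apply: ideal_closedM.
by move=> /pP[/Pm //|/pP[/Pm //|]].
Qed.

Lemma extension_prime : prime_ideal extension.
Proof.
split=> [|x y]; first by rewrite -(rmorph1 lam) extensionE; case: primeP.
have [a [s [ms sx]]] := loc_fracP x; have [b [t [mt ty]]] := loc_fracP y.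
move=> exy; have: extension (lam (a * b)).
  have -> : lam (a * b) = lam s * lam t * (x * y).
    by rewrite rmorphM -sx -ty; ring.
  exact: ideal_closedM.
rewrite extensionE; case: primeP => _ pP /pP[Pa|Pb].
  by left; exists a, s.
by right; exists b, t.
Qed.

End Extension.

Lemma extension_proper (P Q : ideal R) :
  prime_ideal P -> J `<=` P -> Q `<=` m -> P `<` Q ->
  extension P `<` extension Q.
Proof.
move=> primeP JP Qm [PQ QP].
split=> [x [a [s [Pa ms sx]]]|sub]; first by exists a, s; split=> //; apply: PQ.
apply: QP => a Qa; apply/(extensionE primeP JP (subset_trans PQ Qm)).
apply: sub.
by exists a, 1; rewrite rmorph1 mul1r; split=> //; case: primem.
Qed.

Lemma extension_m_unit x : ~ extension m x -> exists u, u * x = 1.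
Proof.
move=> mx; have [a [s [ms sx]]] := loc_fracP x.
have [ma|/loc_unit[u ua]] := pselect (m a); first by case: mx; exists a, s.
by exists (u * lam s); rewrite -mulrA sx.
Qed.

Lemma loc_local_ring : local_ring (extension m).
Proof.
have [ext1 _] := extension_prime primem Jm (@subset_refl _ m).
have sub (I : ideal L) : ~ I 1 -> I `<=` extension m.
  move=> I1 x Ix; apply: contrapT => /extension_m_unit[u ux].
  by apply: I1; rewrite -ux; apply: ideal_closedM.
split; first by split=> // I _; apply: sub.
move=> m' [m'1 maxm']; rewrite eqEsubset; split; first exact: sub.
by apply: maxm' => //; apply: sub.
Qed.

Lemma loc_chain_contraction n (Q : nat -> ideal L) : prime_chain n Q ->
  prime_chain n (fun i => contraction (Q i)) /\ J `<=` contraction (Q 0%N).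
Proof.
move=> [primeQ ltQ]; split; last exact: contraction_ker.
split=> i lei; first exact: contraction_prime (primeQ i lei).
exact: contraction_proper (ltQ i lei).
Qed.

Lemma loc_chain_extension n (P : nat -> ideal R) :
  prime_chain n P -> J `<=` P 0%N -> P n `<=` m ->
  prime_chain n (fun i => extension (P i)).
Proof.
move=> chainP JP Pm.
have JPi i : (i <= n)%N -> J `<=` P i.
  by move=> lei; apply: subset_trans JP (prime_chain_sub0 chainP lei).
have Pim i : (i <= n)%N -> P i `<=` m.
  by move=> lei; apply: subset_trans (prime_chain_subn chainP lei) Pm.
have [primeP ltP] := chainP; split=> i lei.
  by apply: extension_prime; [apply: primeP|apply: JPi|apply: Pim].
apply: extension_proper; first exact: primeP (ltnW lei).
- exact: JPi (ltnW lei).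
- exact: Pim.
exact: ltP.
Qed.

(** The last hypothesis says that [g] is a nonzerodivisor modulo J + (f). Relations over [L] become
    relations modulo [J] after clearing denominators, and the factors introduced are units of
    [L]. *)
Lemma loc_regular_sequence2 f g : m f -> m g ->
  (forall a, J (f * a) -> J a) ->
  (forall a b, J (g * a - f * b) -> exists c, J (a - f * c)) ->
  regular_sequence [:: lam f; lam g].
Proof.
move=> mf mg regf regg; split=> [[|[|//]] _ x|]; rewrite /= ?take0; last first.
- suff sub: ideal_gen [set x | x \in [:: lam f; lam g]] `<=` extension m.
    move=> /sub; rewrite -(rmorph1 lam) extensionE //; by case: primem.
  apply: ideal_gen_min => x /=; rewrite !inE => /orP[] /eqP->.
    by apply/extensionE.
  by apply/extensionE.
- move=> /ideal_gen_seq1[c gxcf]; apply/ideal_gen_seq1.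
  have [a [s [ms sx]]] := loc_fracP x; have [b [t [mt tc]]] := loc_fracP c.
  have /loc_eqP[r mr] : lam (t * g * a) = lam (s * b * f).
    rewrite !rmorphM -sx -tc.
    have -> : lam t * lam g * (lam s * x) = lam t * lam s * (lam g * x) by ring.
    by rewrite gxcf; ring.
  have -> : r * (t * g * a - s * b * f) = g * (r * t * a) - f * (r * s * b).
    by ring.
  move=> /regg[d Jd].
  have [u us] := loc_unit (notin_primeM (notin_primeM mr mt) ms).
  have ea : lam (r * t * a) = lam d * lam f.
    rewrite [RHS]mulrC -rmorphM; apply/loc_eqP; exists 1; first by case: primem.
    by rewrite mul1r.
  exists (u * lam d); rewrite -mulrA -ea -[LHS]mul1r -us !rmorphM -sx.
  by ring.
- move=> /ideal_gen_nil fx0; apply/ideal_gen_nil.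
  have [a [s [ms sx]]] := loc_fracP x; apply: (loc_mulI ms).
  rewrite sx mulr0; have: lam (f * a) = 0.
    by rewrite rmorphM -sx mulrCA fx0 mulr0.
  move=> /loc_kerP[t mt Jtfa]; apply/loc_kerP; exists t => //.
  by apply: regf; rewrite mulrCA.
Qed.

(* A regular sequence of length [n] yields a chain of [n] strict inclusions of
   primes, so bounding the dimension by 2 also bounds the depth. *)
Lemma loc_cohen_macaulay2 f g : noetherian R -> m f -> m g ->
  (forall a, J (f * a) -> J a) ->
  (forall a b, J (g * a - f * b) -> exists c, J (a - f * c)) ->
  (forall n (P : nat -> ideal R), prime_chain n P -> J `<=` P 0%N ->
     (n <= 2)%N) ->
  cohen_macaulay_local L.
Proof.
move=> noethR mf mg regf regg dimJ.
have dimL n (Q : nat -> ideal L) : prime_chain n Q -> (n <= 2)%N.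
  by move=> /loc_chain_contraction[chainQ JQ]; apply: dimJ chainQ JQ.
have reg2 := loc_regular_sequence2 mf mg regf regg.
split; first exact: loc_noetherian.
exists (extension m); split; first exact: loc_local_ring.
exists 2%N; split; split=> //; last exact: regular_sequence_chain reg2.
  exists [:: lam f; lam g]; split=> // x; rewrite !inE.
  by move=> /orP[] /eqP->; apply/extensionE.
by move=> xs /regular_sequence_chain[Q /dimL].
Qed.

End LocalizationMap.

(** * Ideals along a surjective ring morphism *)

Section Surjection.
Local Open Scope ring_scope.
Local Open Scope classical_set_scope.
Variables (R L : comPzRingType) (h : {rmorphism R -> L}).
Hypothesis h_surj : forall x, exists a, h a = x.

Section Image.
Variable I : ideal R.
#[local] Obligation Tactic := idtac.

Program Definition image_ideal : ideal L :=
  @Ideal L [set x | exists2 a, I a & h a = x] _ _ _.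
Next Obligation. by exists 0; [apply: ideal_has0|rewrite rmorph0]. Qed.
Next Obligation.
move=> _ _ [a Ia <-] [b Ib <-]; exists (a + b); first exact: ideal_closedD.
by rewrite rmorphD.
Qed.
Next Obligation.
move=> y _ [a Ia <-]; have [b <-] := h_surj y.
by exists (b * a); [apply: ideal_closedM|rewrite rmorphM].
Qed.

Lemma image_idealE a : (forall b, h b = 0 -> I b) -> image_ideal (h a) <-> I a.
Proof.
move=> kerI; split=> [[b Ib hba]|Ia]; last by exists a.
have Iba : I (b - a) by apply: kerI; rewrite rmorphB hba subrr.
exact/(ideal_subE Iba).
Qed.

End Image.

Lemma contraction_maximal (Q : ideal L) :
  maximal_ideal Q -> maximal_ideal (contraction h Q).
Proof.
move=> [Q1 maxQ]; split=> [|I QI I1]; first by rewrite /= rmorph1.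
have kerI b : h b = 0 -> I b.
  by move=> hb0; apply: QI; rewrite /= hb0; apply: ideal_has0.
move=> a Ia; apply: (maxQ (image_ideal I)); last exact/image_idealE.
  move=> x; have [b <-] := h_surj x => Qb.
  by apply/image_idealE => //; apply: QI.
by rewrite -(rmorph1 h) image_idealE.
Qed.

Lemma image_ideal_maximal (m : ideal R) : (forall b, h b = 0 -> m b) ->
  maximal_ideal m -> maximal_ideal (image_ideal m).
Proof.
move=> kerm [m1 maxm]; split=> [|I mI I1].
  by rewrite -(rmorph1 h) image_idealE.
move=> x; have [a <-] := h_surj x => Ia; apply/image_idealE => //.
apply: (maxm (contraction h I)) => //=; last by rewrite rmorph1.
by move=> b mb; apply: mI; apply/image_idealE.
Qed.

Lemma noetherian_surj : noetherian R -> noetherian L.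
Proof.
move=> noethR I; have [xs exs] := noethR (contraction h I).
exists [seq h x | x <- xs]; rewrite eqEsubset; split.
  apply: ideal_gen_min => _ /mapP[x x_xs ->].
  suff: contraction h I x by [].
  by rewrite -exs; apply: ideal_gen_incl.
move=> x Ix; have [a hax] := h_surj x; rewrite -hax in Ix *.
have: ideal_gen [set x | x \in xs] a by rewrite exs.
apply: (@ideal_gen_min _ _
  (contraction h (ideal_gen [set x | x \in [seq h x | x <- xs]]))).
by move=> y xs_y; apply: ideal_gen_incl; apply/mapP; exists y.
Qed.

End Surjection.

(** * The local rings of R / J *)

Section LocalizedQuotient.
Local Open Scope ring_scope.
Local Open Scope classical_set_scope.
Local Open Scope quotient_scope.

Variables (R : comPzRingType) (J : ideal R).

Definition quotient_pi (a : R) : quotient J := \pi_(quotient J) a.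

Lemma quotient_pi_is_additive : zmod_morphism quotient_pi.
Proof.
move=> a b; apply: (addIr (quotient_pi b)).
by rewrite /quotient_pi -quotient_piD !subrK.
Qed.

Lemma quotient_pi_is_multiplicative : monoid_morphism quotient_pi.
Proof. by split=> [//|a b]; rewrite /quotient_pi quotient_piM. Qed.

HB.instance Definition _ :=
  GRing.isZmodMorphism.Build R (quotient J) quotient_pi quotient_pi_is_additive.
HB.instance Definition _ :=
  GRing.isMonoidMorphism.Build R (quotient J) quotient_pi
    quotient_pi_is_multiplicative.

Lemma quotient_pi_surj x : exists a, quotient_pi a = x.
Proof. by exists (repr x); apply: reprK. Qed.

Lemma quotient_pi_eq0 a : quotient_pi a = 0 <-> J a.
Proof.
by rewrite -(rmorph0 quotient_pi) /quotient_pi quotient_eqP subr0.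
Qed.

Variable P : ideal (quotient J).
Hypothesis primeP : prime_ideal P.

(** The composite of R -> R / J with the localization map: it lets the local rings of the quotient
    be treated through elements of [R]. *)
Definition locq (a : R) : localization primeP :=
  Defs.frac primeP (quotient_pi a) (denominator1 primeP).

Lemma locq_is_additive : zmod_morphism locq.
Proof.
have locqD a b : locq (a + b) = locq a + locq b.
  rewrite /locq rmorphD [RHS]loc_addE; apply: frac_eq => /=.
  by ring.
by move=> a b; apply: (addIr (locq b)); rewrite -locqD !subrK.
Qed.

Lemma locq_is_multiplicative : monoid_morphism locq.
Proof.
split=> [//|a b]; rewrite /locq rmorphM.
by rewrite [RHS]loc_mulE; apply: frac_eq => /=; rewrite !mulr1.
Qed.

HB.instance Definition _ :=
  GRing.isZmodMorphism.Build R (localization primeP) locq locq_is_additive.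
HB.instance Definition _ :=
  GRing.isMonoidMorphism.Build R (localization primeP) locq
    locq_is_multiplicative.


Lemma locq_is_localization :
  is_localization locq J (contraction quotient_pi P).
Proof.
split=> [a|s Ps|].
- rewrite -(rmorph0 locq) /locq frac_eqP; split=> [[u]|[s Ps Jsa]].
    have := @denominatorP _ _ u; elim/quotientW: (val u) => b Pb.
    rewrite -[\pi_(quotient J) b]/(quotient_pi b) rmorph0 mul0r subr0 mulr1.
    rewrite -rmorphM => /quotient_pi_eq0 Jba.
    by exists b.
  have Ps' : `[< ~ P (quotient_pi s) >] by apply/asboolP.
  exists (exist _ (quotient_pi s) Ps').
  rewrite /= rmorph0 mul0r subr0 mulr1 -rmorphM.
  by apply/quotient_pi_eq0.
- have Ps' : `[< ~ P (quotient_pi s) >] by apply/asboolP.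
  exists (Defs.frac primeP 1 (exist _ (quotient_pi s) Ps')).
  rewrite [LHS]loc_mulE; apply: frac_eq => /=.
  by rewrite !mul1r !mulr1.
elim/(@fracW _ _ primeP) => x t; have [a <-] := quotient_pi_surj x.
have := @denominatorP _ _ t; have [s es] := quotient_pi_surj (val t).
rewrite -es => Ps; exists a, s; split=> //.
by rewrite [LHS]loc_mulE; apply: frac_eq; rewrite /= -es !mulr1 !mul1r mulrC.
Qed.

End LocalizedQuotient.

(** * The Cohen-Macaulay property of R / J in terms of [R] *)

Section CohenMacaulayQuotient.
Local Open Scope ring_scope.
Local Open Scope classical_set_scope.
Variables (R : comPzRingType) (J : ideal R).

Lemma cohen_macaulay_ideal2 :
  noetherian R ->
  (forall n (P : nat -> ideal R), prime_chain n P -> J `<=` P 0%N ->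
     (n <= 2)%N) ->
  (forall m : ideal R, maximal_ideal m -> J `<=` m -> exists f g,
     [/\ m f, m g, forall a, J (f * a) -> J a &
       forall a b, J (g * a - f * b) -> exists c, J (a - f * c)]) ->
  cohen_macaulay_ideal J.
Proof.
move=> noethR dimJ regJ; have piS := @quotient_pi_surj R J; split.
  exact: noetherian_surj piS noethR.
move=> P maxP; set primeP := maximal_ideal_prime maxP.
have maxm := contraction_maximal piS maxP.
have Jm : J `<=` contraction (quotient_pi J) P.
  by move=> a /quotient_pi_eq0 pia; rewrite /= pia; apply: ideal_has0.
have [f [g [mf mg regf regg]]] := regJ _ maxm Jm.
exact: (loc_cohen_macaulay2 (maximal_ideal_prime maxm) Jm
  (locq_is_localization primeP) noethR mf mg regf regg dimJ).
Qed.

(** The chain gives the local ring at [m] dimension, hence depth, at least 2. The first two members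
    of a regular sequence of length [d] have numerators [f] and [g] in [m]; the factors [s] outside
    [m] absorb the denominators. *)
Lemma cohen_macaulay_ideal_regular (m : ideal R) (P : nat -> ideal R) :
  cohen_macaulay_ideal J -> maximal_ideal m ->
  prime_chain 2 P -> J `<=` P 0%N -> P 2%N `<=` m ->
  exists f g, [/\ m f, m g,
    forall a, J (f * a) -> exists2 s, ~ m s & J (s * a) &
    forall a b, J (g * a - f * b) ->
      exists s c, ~ m s /\ J (s * a - f * c)].
Proof.
move=> [_ CM] maxm chainP JP Pm; have piS := @quotient_pi_surj R J.
have Jm : J `<=` m.
  apply: subset_trans Pm; apply: subset_trans JP _.
  exact: prime_chain_sub0 chainP _.
have kerm b : quotient_pi J b = 0 -> m b by move=> /quotient_pi_eq0/Jm.
have maxM := image_ideal_maximal piS kerm maxm.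
have [_ [n [locn [d [[[xs [[regxs _] nxs szxs]] _] [_ dimd]]]]]] := CM _ maxM.
set primeM := maximal_ideal_prime maxM in n locn d xs regxs nxs szxs dimd.
pose lam : {rmorphism R -> localization primeM} := locq primeM.
have eqm : contraction (quotient_pi J) (image_ideal piS m) = m.
  apply: ideal_ext; rewrite eqEsubset.
  by split=> a ma; apply/(image_idealE piS a kerm).
have locL : is_localization lam J m.
  by have := locq_is_localization primeM; rewrite eqm.
have primem := maximal_ideal_prime maxm.
have le2d : (2 <= d)%N.
  exact: dimd (loc_chain_extension primem locL chainP JP Pm).
have [_ /(_ _ (loc_local_ring primem Jm locL).1) en] := locn.
have lt i : (i < 2)%N -> (i < size xs)%N.
  by move=> lti; rewrite szxs; apply: leq_trans lti le2d.
have xsP i : (i < 2)%N -> exists a s, [/\ m a, ~ m s & lam s * xs`_i = lam a].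
  move=> /lt lti; have := nxs _ (mem_nth 0 lti); rewrite -en.
  exact.
have [f [s [mf ms sf]]] := xsP 0%N isT; have [g [t [mg mt tg]]] := xsP 1%N isT.
exists f, g; split=> // [a Jfa|a b Jgafb].
  apply/(loc_kerP locL)/(ideal_gen_nil _).
  rewrite -(take0 xs); apply: (regxs 0%N (lt 0%N isT) (lam a)).
  rewrite take0; apply/ideal_gen_nil; apply: (loc_mulI locL ms).
  by rewrite mulr0 mulrA sf -rmorphM (loc_ker primem locL).
have take1 : take 1 xs = [:: xs`_0].
  by rewrite (take_nth 0) ?take0 ?(lt 0%N).
have := regxs 1%N (lt 1%N isT) (lam t * lam a); rewrite take1.
case/(_ _)/ideal_gen_seq1.
  apply/ideal_gen_seq1; exists (lam s * lam b).
  rewrite mulrA [_ * lam t]mulrC tg mulrAC sf -!rmorphM.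
  apply/(loc_eqP locL); exists 1; first by have [] := primem.
  by rewrite mul1r.
move=> c tac; have [c' [u [mu uc]]] := loc_fracP locL c.
have /(loc_eqP locL)[r mr Jr] : lam (s * u * t * a) = lam (f * c').
  rewrite !rmorphM -sf -uc -(mulrA _ (lam t)) tac; ring.
exists (r * (s * u * t)), (r * c'); split; last first.
  by have -> : r * (s * u * t) * a - f * (r * c') = r * (s * u * t * a - f * c')
    by ring.
by do !apply: notin_primeM.
Qed.

End CohenMacaulayQuotient.

(** * Hilbert's basis theorem *)

Section Hilbert.
Local Open Scope ring_scope.
Local Open Scope classical_set_scope.

Section LeadIdeal.
Variables (R : comNzRingType) (I : ideal {poly R}) (d : nat).
#[local] Obligation Tactic := idtac.

(** Members of smaller degree contribute the coefficient 0, which makes the set closed under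
    addition. *)
Program Definition lead_ideal : ideal R :=
  @Ideal R [set c | exists f : {poly R},
    [/\ I f, (size f <= d.+1)%N & f`_d = c]] _ _ _.
Next Obligation.
by exists 0; rewrite coef0 size_poly0; split=> //; apply: ideal_has0.
Qed.
Next Obligation.
move=> _ _ [f [If szf <-]] [g [Ig szg <-]]; exists (f + g); rewrite coefD.
split=> //; first exact: ideal_closedD.
by apply: leq_trans (size_polyD f g) _; rewrite geq_max szf.
Qed.
Next Obligation.
move=> a _ [f [If szf <-]]; exists (a%:P * f); rewrite coefCM.
split=> //; first exact: ideal_closedM.
by rewrite mul_polyC; apply: leq_trans (size_scale_leq _ _) szf.
Qed.

End LeadIdeal.

Lemma lead_ideal_leq (R : comNzRingType) (I : ideal {poly R}) d e :
  (d <= e)%N -> lead_ideal I d `<=` lead_ideal I e.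
Proof.
move=> led _ [f [If szf <-]]; exists (f * 'X^(e - d)); split.
- exact: ideal_closedMr.
- apply: leq_trans (size_polyMleq _ _) _; rewrite size_polyXn; lia.
by rewrite coefMXn ltnNge leq_subr /= subKn.
Qed.

(** The lead ideals increase with the degree and their union is finitely generated, so they stop
    growing at some [N]. Polynomials realizing generators of the lead ideals up to [N] then generate
    [I]. *)
Theorem noetherian_poly (R : comNzRingType) :
  noetherian R -> noetherian {poly R}.
Proof.
move=> noethR I.
have U0 : exists d, lead_ideal I d 0 by exists 0%N; apply: ideal_has0.
have UD x y : (exists d, lead_ideal I d x) -> (exists d, lead_ideal I d y) ->
    exists d, lead_ideal I d (x + y).
  move=> [d Lx] [e Ly]; exists (maxn d e); apply: ideal_closedD.
    exact: lead_ideal_leq (leq_maxl d e) _ Lx.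
  exact: lead_ideal_leq (leq_maxr d e) _ Ly.
have UM a x : (exists d, lead_ideal I d x) -> exists d, lead_ideal I d (a * x).
  by move=> [d Lx]; exists d; apply: ideal_closedM.
have [us eus] := noethR (Ideal U0 UD UM).
have [N usN] : exists N, forall u, u \in us -> lead_ideal I N u.
  have: forall u, u \in us -> exists d, lead_ideal I d u.
    move=> u us_u; suff: ideal_gen [set x | x \in us] u by rewrite eus.
    exact: ideal_gen_incl.
  elim: (us) => [|u vs IHvs] Lus; first by exists 0%N.
  have [v vs_v|N LN] := IHvs; first by apply: Lus; rewrite inE vs_v orbT.
  have [M LM] := Lus u (mem_head _ _); exists (maxn M N) => v.
  rewrite inE => /predU1P[->|/LN].
    exact: lead_ideal_leq (leq_maxl _ _) _ LM.
  exact: (lead_ideal_leq (leq_maxr _ _)).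
have LN d : lead_ideal I d `<=` lead_ideal I N.
  move=> c Lc; have : ideal_gen [set x | x \in us] c by rewrite eus; exists d.
  exact: ideal_gen_min.
have /choice[G GP] : forall d, exists gs : seq {poly R},
    (forall g, g \in gs -> I g /\ (size g <= d.+1)%N) /\
    lead_ideal I d `<=`
      ideal_gen [set x | x \in [seq (g : {poly R})`_d | g <- gs]].
  move=> d; have [cs ecs] := noethR (lead_ideal I d).
  have /choice[F FP] : forall c, exists f : {poly R}, c \in cs ->
      [/\ I f, (size f <= d.+1)%N & f`_d = c].
    move=> c; have [cs_c|_] := boolP (c \in cs); last by exists 0.
    have: ideal_gen [set x | x \in cs] c by apply: ideal_gen_incl.
    by rewrite ecs => -[f fP]; exists f.
  exists [seq F c | c <- cs]; split=> [_ /mapP[c /FP[? ? ?] ->] //|].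
  rewrite -ecs; apply: ideal_gen_min => c cs_c; apply: ideal_gen_incl => /=.
  rewrite -map_comp; apply/mapP; exists c => //=.
  by case: (FP c cs_c).
pose gs := flatten [seq G d | d <- iota 0 N.+1].
have gsP g : g \in gs <-> exists2 d, (d <= N)%N & g \in G d.
  split=> [/flatten_mapP[d]|[d led Gd]].
    by rewrite mem_iota => led Gd; exists d.
  by apply/flatten_mapP; exists d => //; rewrite mem_iota.
exists gs; rewrite eqEsubset; split=> [|f If].
  by apply: ideal_gen_min => g /gsP[d _ /((GP d).1 g)[]].
have leadG d : lead_ideal I d `<=`
    lead_ideal (ideal_gen [set x | x \in gs]) d.
  have small e : (e <= N)%N -> lead_ideal I e `<=`
      lead_ideal (ideal_gen [set x | x \in gs]) e.
    move=> leeN; apply: subset_trans (GP e).2 _.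
    apply: ideal_gen_min => _ /mapP[g Gg ->]; exists g; split=> //.
      by apply: ideal_gen_incl; apply/gsP; exists e.
    by case: ((GP e).1 g Gg).
  have [/small //|ltNd c /LN /small Lc] := leqP d N.
  by apply: (lead_ideal_leq (ltnW ltNd)); apply: Lc.
elim/ltn_ind: {f}(size f) {-2}f (leqnn (size f)) If => n IHn f.
case: n IHn => [|n] IHn szf If.
  by move: szf; rewrite leqn0 size_poly_eq0 => /eqP->; apply: ideal_has0.
(* Subtracting a member [h] of the generated ideal with the same coefficient at [n] lowers the
   size. *)
have [|h [gh szh hn]] := leadG n f`_n; first by exists f.
rewrite -(subrK h f); apply: ideal_closedD => //.
have Ih : I h.
  by move: gh; apply: ideal_gen_min => g /gsP[d _ /((GP d).1 g)[]].
apply: (IHn n) => //; last exact: ideal_closedB.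
apply/leq_sizeP => j; rewrite leq_eqVlt => /predU1P[<-|ltnj].
  by rewrite coefB hn subrr.
rewrite coefB !nth_default ?subrr //; first exact: leq_trans szh _.
exact: leq_trans szf _.
Qed.

Lemma noetherian_field (K : fieldType) : noetherian K.
Proof.
move=> I; have [[x Ix x0]|I0] := pselect (exists2 x, I x & x != 0).
  exists [:: x]; rewrite eqEsubset; split=> [|y _].
    by apply: ideal_gen_min => y /=; rewrite inE => /eqP->.
  rewrite -(divfK x0 y); apply: ideal_closedM; apply: ideal_gen_incl.
  by rewrite /= inE.
exists [::]; rewrite eqEsubset; split=> [|y Iy]; first exact: ideal_gen_min.
have [->|y0] := eqVneq y 0; first exact: ideal_has0.
by case: I0; exists y.
Qed.

Lemma mpoly_ring_ind (R : comNzRingType) n (P : {mpoly R[n]} -> Prop) :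
  (forall c, P c%:MP) -> (forall i, P 'X_i) ->
  (forall p q, P p -> P q -> P (p + q)) ->
  (forall p q, P p -> P q -> P (p * q)) -> forall p, P p.
Proof.
move=> PC PX PD PM p; rewrite [p]mpolyE; apply: big_ind => //.
  by rewrite -mpolyC0.
move=> m _; rewrite -mul_mpolyC; apply: (PM) => //.
rewrite mpolyXE_id; apply: (big_ind P) => // [|i _]; first by rewrite -mpolyC1.
by elim: (m i) => [|k IHk]; rewrite ?expr0 -?mpolyC1 // exprS; apply: (PM).
Qed.

(** Sending ['X] to the last variable maps the univariate polynomials over [{mpoly K[n]}] onto
    [{mpoly K[n.+1]}]. *)
Theorem noetherian_mpoly (K : fieldType) n : noetherian {mpoly K[n]}.
Proof.
elim: n => [|n IHn].
  apply: (@noetherian_surj _ _ (@mpolyC 0 K : {rmorphism K -> {mpoly K[0]}})).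
    by move=> p; exists p@_0%MM; rewrite /= [RHS]nvar0_mpolyC.
  exact: noetherian_field.
have comm : commr_rmorph (@mwiden n K) 'X_ord_max by move=> p; apply: mulrC.
apply: (@noetherian_surj _ _ (horner_morph comm : {rmorphism _ -> _})).
  elim/mpoly_ring_ind=> [c|i|_ _ [p <-] [q <-]|_ _ [p <-] [q <-]].
  - by exists c%:MP%:P; rewrite /= horner_morphC /= mwidenC.
  - have [i' -> | ->] := unliftP ord_max i.
      exists ('X_i')%:P; rewrite /= horner_morphC /= mwidenX mnmwiden1.
      by congr 'X_[U_(_)]; apply: val_inj; rewrite /= /bump leqNgt ltn_ord.
    by exists 'X; rewrite /= horner_morphX.
  - by exists (p + q); rewrite rmorphD.
  - by exists (p * q); rewrite rmorphM.
exact: noetherian_poly IHn.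
Qed.

End Hilbert.

(** * Polynomials in two variables *)

Section Nullstellensatz.
Local Open Scope ring_scope.
Variable K : fieldType.

(* If [f] has minimal degree among the nonzero members of [n] and leading
   coefficient [D], then pseudo-division by [f] shows that [1 + 'X * D] can
   only be invertible modulo [n] if it divides a power of [D]. *)
Lemma maximal_bivariate_const (n : ideal {poly {poly K}}) :
  ~ n 1 -> (forall x, ~ n x -> exists u, n (u * x - 1)) ->
  exists2 q : {poly K}, q != 0 & n q%:P.
Proof.
move=> n1 invn; apply: contrapT => nconst.
have nC (q : {poly K}) : n q%:P -> q = 0.
  by move=> nq; apply/eqP; apply: contrapT => /negP q0; apply: nconst; exists q.
have [f [nf f0 minf]] : exists f, [/\ n f, f != 0 &
    forall g, n g -> (size g < size f)%N -> g = 0].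
  have ex : exists k, `[< exists2 f, n f & f != 0 /\ size f = k >].
    (* Either ['X] lies in [n], or an inverse [u] of it modulo [n] gives the member [u * 'X - 1],
       whose constant coefficient is -1. *)
    suff [f nf f0] : exists2 f, n f & f != 0.
      by exists (size f); apply/asboolP; exists f.
    have [nX|/invn[u nu]] := pselect (n 'X).
      by exists 'X => //; rewrite polyX_eq0.
    exists (u * 'X - 1) => //; apply/eqP.
    move=> /(congr1 (fun p : {poly {poly K}} => p`_0)).
    rewrite coefB coefMX coef1 coef0 sub0r => /eqP.
    by rewrite oppr_eq0 oner_eq0.
  case: (ex_minnP ex) => k /asboolP[f nf [f0 szf]] mink.
  exists f; split=> // g ng ltgf; apply/eqP; apply: contrapT => /negP g0.
  suff /mink : `[< exists2 h, n h & h != 0 /\ size h = size g >].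
    by rewrite -szf leqNgt ltgf.
  by apply/asboolP; exists g.
have szf : (1 < size f)%N.
  rewrite ltnNge; apply/negP => /size1_polyC ef; move: nf f0.
  by rewrite ef => /nC->; rewrite eqxx.
set D := lead_coef f; have D0 : D != 0 by rewrite lead_coef_eq0.
pose q : {poly K} := 1 + D * 'X.
have szq : (1 < size q)%N.
  rewrite /q addrC size_polyDl size_mulX // ?size_poly1 //.
    by rewrite ltnS size_poly_gt0.
  by rewrite ltnS size_poly_gt0.
have [u nu] : exists u, n (u * q%:P - 1).
  apply: invn => /nC q0; by rewrite q0 size_poly0 in szq.
have divf g : exists l w r, (D ^+ l)%:P * g = w * f + r /\ (size r < size f)%N.
  exists (scalp g f), (g %/ f), (g %% f); rewrite ltn_modp f0.
  by rewrite mul_polyC Pdiv.Idomain.divp_eq.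
have [k [v [h [eh szh]]]] := divf (u * q%:P - 1).
have h0 : h = 0.
  apply: minf => //; have -> : h = (D ^+ k)%:P * (u * q%:P - 1) - v * f.
    by rewrite eh; ring.
  by apply: ideal_closedB; apply: ideal_closedM.
rewrite {h szh}h0 addr0 in eh.
have [l [w [r [er szr]]]] := divf u.
(* Up to powers of [D] the inverse [u] is replaced by its remainder [r]. The difference of [q * r]
   and [D ^+ l] is then smaller than [f], while a nonzero multiple of it is divisible by [f]; hence
   it vanishes, and its constant coefficient shows that [q] divides [D ^+ l]. *)
have E : (D ^+ k)%:P * (q%:P * r - (D ^+ l)%:P) =
    ((D ^+ l)%:P * v - (D ^+ k)%:P * q%:P * w) * f.
  have -> : r = (D ^+ l)%:P * u - w * f by rewrite er; ring.
  transitivity ((D ^+ l)%:P * ((D ^+ k)%:P * (u * q%:P - 1))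
    - (D ^+ k)%:P * q%:P * w * f); first by ring.
  by rewrite eh; ring.
have Dk0 j : (D ^+ j)%:P != 0 by rewrite polyC_eq0 expf_neq0.
have szE : (size (q%:P * r - (D ^+ l)%:P)%R < size f)%N.
  apply: leq_ltn_trans (size_polyD _ _) _; rewrite size_polyN gtn_max.
  rewrite (leq_ltn_trans (size_polyC_leq1 _) szf) andbT.
  by rewrite mul_polyC (leq_ltn_trans (size_scale_leq _ _) szr).
have /eqP : q%:P * r - (D ^+ l)%:P = 0.
  apply/eqP; apply: contraLR szE => E0; rewrite -leqNgt.
  set W := _ - _ * w in E.
  have W0 : W != 0.
    apply/eqP => W0; move/eqP: E; rewrite W0 mul0r mulf_eq0.
    by rewrite (negPf (Dk0 k)) (negPf E0).
  have <- : size ((D ^+ k)%:P * (q%:P * r - (D ^+ l)%:P)) =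
      size (q%:P * r - (D ^+ l)%:P) by apply/size_Cmul/expf_neq0.
  rewrite E size_mul //.
  by rewrite -subn1 -addnBAC ?size_poly_gt0 // leq_addl.
rewrite subr_eq0 => /eqP/(congr1 (fun p : {poly {poly K}} => p`_0)).
rewrite coefCM coefC eqxx => qr.
have cop : coprimep q (D ^+ l).
  rewrite coprimep_expr // /q; apply/Bezout_coprimepP.
  exists (1, - 'X) => /=; have -> : 1 * (1 + D * 'X) + - 'X * D = 1 :> {poly K}.
    by ring.
  exact: eqpxx.
have dvq : q %| D ^+ l by rewrite -qr dvdp_mulr.
move: cop; rewrite /coprimep => /eqP szg.
have := dvdp_gcd q q (D ^+ l); rewrite dvdpp dvq => /dvdp_leq.
by rewrite szg -size_poly_gt0 szg => /(_ isT); rewrite leqNgt szq.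
Qed.

End Nullstellensatz.

(** * Algebraic dependence of three polynomials *)

Section Dependence.
Local Open Scope ring_scope.

Lemma linear_dependence (K : fieldType) (I J : finType) (M : I -> J -> K) :
  (#|J| < #|I|)%N -> exists2 k : I -> K, exists i, k i != 0 &
    forall j, \sum_i k i * M i j = 0.
Proof.
move=> ltJI; pose A := \matrix_(i < #|I|, j < #|J|) M (enum_val i) (enum_val j).
have : kermx A != 0.
  rewrite -mxrank_eq0 mxrank_ker subn_eq0 -ltnNge.
  exact: leq_ltn_trans (rank_leq_col A) ltJI.
move=> /rowV0Pn[k /sub_kermxP kA k0].
exists (fun i => k 0 (enum_rank i)) => [|j].
  have [[i ki]|k0'] := pselect (exists i, k 0 i != 0); last first.
    case/negP: k0; apply/eqP/rowP => i; rewrite mxE; apply/eqP.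
    by apply: contrapT => /negP ki; apply: k0'; exists i.
  by exists (enum_val i); rewrite enum_valK.
have := congr1 (fun B : 'rV_ _ => B 0 (enum_rank j)) kA; rewrite !mxE => kA0.
rewrite -[RHS]kA0.
rewrite (reindex (@enum_val _ I)) /=; last first.
  by apply: onW_bij; apply: enum_val_bij.
by apply: eq_bigr => i _; rewrite mxE enum_valK enum_rankK.
Qed.

Section Evaluation.
Variables (T S : comNzRingType) (eps : {rmorphism T -> S}) (f : S).

Lemma eval_comm : commr_rmorph eps f.
Proof. by move=> x; apply: mulrC. Qed.

Definition eval_at : {rmorphism {poly T} -> S} := horner_morph eval_comm.

Lemma eval_atE (p : {poly T}) N : (size p <= N)%N ->
  eval_at p = \sum_(i < N) eps p`_i * f ^+ i.
Proof.
move=> szp; rewrite /eval_at /= /horner_morph (@horner_coef_wide _ N).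
  by apply: eq_bigr => i _; rewrite coef_map.
exact: leq_trans (size_poly _ _) szp.
Qed.

(** As [P] is prime and misses [f], powers of [f] can be divided off until the constant coefficient
    is nonzero. *)
Lemma eval_at_lowest (P : ideal S) (q : {poly T}) :
  prime_ideal P -> ~ P f -> q != 0 -> P (eval_at q) ->
  exists c y, c != 0 /\ P (eps c + f * y).
Proof.
move=> primeP Pf; elim/poly_ind: q => [|q c IHq]; first by rewrite eqxx.
have [->|c0 _] := eqVneq c 0.
  rewrite addr0 rmorphM /= horner_morphX => qX0.
  have q0 : q != 0 by apply: contraNneq qX0 => ->; rewrite mul0r.
  by case: primeP => _ pP /pP[/(IHq q0)|].
rewrite rmorphD rmorphM /= horner_morphX horner_morphC => Pc.
by exists c, (eval_at q); rewrite addrC mulrC.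
Qed.

End Evaluation.

Section Three.
Variables (K S : comNzRingType) (eps : {rmorphism K -> S}) (f0 f1 f2 : S).

Definition eval_at3 : {rmorphism {poly {poly {poly K}}} -> S} :=
  eval_at (eval_at (eval_at eps f2) f1) f0.

(* Stripping off the lowest power of [f0], then of [f1], then of [f2] moves a
   relation from [P 0] up the chain until it becomes a nonzero constant. *)
Lemma dependence_no_chain (P : nat -> ideal S) q : q != 0 ->
  (forall c, c != 0 -> exists d, d * eps c = 1) ->
  prime_chain 3 P -> P 0%N (eval_at3 q) ->
  [/\ ~ P 0%N f0, ~ P 1%N f1 & ~ P 2%N f2] ->
  [/\ P 1%N f0, P 2%N f1 & P 3%N f2] -> False.
Proof.
move=> q0 unitK [primeP ltP] Pq [n0 n1 n2] [h0 h1 h2].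
have step i (T : comNzRingType) (e : {rmorphism T -> S}) f (p : {poly T}) :
    (i < 3)%N -> p != 0 -> ~ P i f -> P i.+1 f -> P i (eval_at e f p) ->
    exists2 c, c != 0 & P i.+1 (e c).
  move=> lti p0 nf hf Pp.
  have [c [y [c0 Pc]]] := eval_at_lowest (primeP _ (ltnW lti)) nf p0 Pp.
  exists c => //; rewrite -(addrK (f * y) (e c)).
  apply: ideal_closedB; last exact: ideal_closedMr.
  exact: (ltP i lti).1.
have [q1 q10 Pq1] := step 0%N _ _ _ _ isT q0 n0 h0 Pq.
have [q2 q20 Pq2] := step 1%N _ _ _ _ isT q10 n1 h1 Pq1.
have [c c0 Pc] := step 2%N _ _ _ _ isT q20 n2 h2 Pq2.
have [P31 _] := primeP 3%N isT; apply: P31.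
by have [d <-] := unitK c c0; apply: ideal_closedM.
Qed.

End Three.

Lemma msizeM_leq (K : fieldType) n (p q : {mpoly K[n]}) :
  (msize (p * q) <= (msize p + msize q).-1)%N.
Proof.
have [->|p0] := eqVneq p 0; first by rewrite mul0r (msize0 n K).
have [->|q0] := eqVneq q 0; first by rewrite mulr0 (msize0 n K).
by rewrite msizeM.
Qed.

Lemma msize_exp_leq (K : fieldType) n (p : {mpoly K[n]}) d k :
  (msize p <= d.+1)%N -> (msize (p ^+ k) <= (d * k).+1)%N.
Proof.
move=> szp; elim: k => [|k IHk]; first by rewrite expr0 msize1.
by rewrite exprS; apply: leq_trans (msizeM_leq _ _) _; lia.
Qed.

(** The products of powers of [f0], [f1], [f2] with exponents below [N] outnumber the monomials in
    the variables [u], [v] that can occur in them, so some nontrivial combination contains no such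
    monomial. *)
Lemma mpoly_dependence3 (K : fieldType) n (u v : 'I_n)
    (f0 f1 f2 : {mpoly K[n]}) :
  exists2 q, q != 0 & forall m,
    m \in msupp (eval_at3 (@mpolyC n K) f0 f1 f2 q) ->
    exists k, [/\ k != u, k != v & m k != 0%N].
Proof.
pose d := maxn (msize f0) (maxn (msize f1) (msize f2)).
(* [M] exceeds the degrees of all these products, and M <= N (3d + 1) gives M^2 < N^3. *)
pose N := ((3 * d + 1) ^ 2).+1; pose M := (3 * N * d + 1)%N.
pose mon (i j : nat) : 'X_{1..n} := (U_(u) *+ i + U_(v) *+ j)%MM.
pose g (t : 'I_N * 'I_N * 'I_N) := f2 ^+ t.2 * f1 ^+ t.1.2 * f0 ^+ t.1.1.
have szg t : (msize (g t) <= M)%N.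
  have sz0 := @msize_exp_leq K n f0 d t.1.1 (leqW (leq_maxl _ _)).
  have sz1 := @msize_exp_leq K n f1 d t.1.2
    (leqW (leq_trans (leq_maxl _ _) (leq_maxr _ _))).
  have sz2 := @msize_exp_leq K n f2 d t.2
    (leqW (leq_trans (leq_maxr _ _) (leq_maxr _ _))).
  have := msizeM_leq (f2 ^+ t.2 * f1 ^+ t.1.2) (f0 ^+ t.1.1).
  have := msizeM_leq (f2 ^+ t.2) (f1 ^+ t.1.2).
  have := ltn_ord t.1.1; have := ltn_ord t.1.2; have := ltn_ord t.2.
  rewrite /M /g; move: sz0 sz1 sz2.
  move: (nat_of_ord t.1.1) (nat_of_ord t.1.2) (nat_of_ord t.2) => a b c.
  move: (msize _) (msize _) (msize _) (msize _) (msize _) => s1 s2 s3 s4 s5.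
  nia.
have [|k [[[a b] c] kabc] ksum] := @linear_dependence K
    ('I_N * 'I_N * 'I_N)%type ('I_M * 'I_M)%type
    (fun t ij => (g t)@_(mon ij.1 ij.2)).
  by rewrite !card_prod !card_ord /M /N; nia.
(* This extends [k] to natural indices, as [\poly] requires: the sum has one term below [N] and none
   beyond. *)
pose coef (a b c : nat) : K := \sum_(t : 'I_N * 'I_N * 'I_N |
  [&& t.1.1 == a :> nat, t.1.2 == b :> nat & t.2 == c :> nat]) k t.
have coefE (x y z : 'I_N) : coef x y z = k (x, y, z).
  rewrite /coef (big_pred1 (x, y, z)) // => -[[x' y'] z'] /=.
  by rewrite andbA.
pose q := \poly_(x < N) \poly_(y < N) \poly_(z < N) coef x y z.
have eq_q : eval_at3 (@mpolyC n K) f0 f1 f2 q = \sum_t k t *: g t.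
  rewrite /eval_at3 (@eval_atE _ _ _ _ _ N) ?size_poly //.
  rewrite (eq_bigr (fun x : 'I_N =>
      \sum_(y < N) \sum_(z < N) k (x, y, z) *: g (x, y, z))).
    by rewrite pair_bigA /= pair_bigA /=; apply: eq_bigr => -[[x1 y1] z1] _.
  move=> x _; rewrite coef_poly ltn_ord (@eval_atE _ _ _ _ _ N) ?size_poly //.
  rewrite mulr_suml; apply: eq_bigr => y _.
  rewrite coef_poly ltn_ord (@eval_atE _ _ _ _ _ N) ?size_poly //.
  rewrite !mulr_suml; apply: eq_bigr => z _.
  by rewrite coef_poly ltn_ord coefE mul_mpolyC /g /= -!scalerAl.
exists q => [|m].
  apply: contraNneq kabc => q0; rewrite -coefE.
  have := congr1 (fun p : {poly {poly {poly K}}} => p`_a`_b`_c) q0.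
  rewrite /q !coef0 !coef_poly !ltn_ord.
  by rewrite coef_poly ltn_ord coef_poly ltn_ord => ->.
rewrite eq_q => msup; apply: contrapT => nk.
have m0 i : i != u -> i != v -> m i = 0%N.
  by move=> iu iv; apply/eqP; apply: contrapT => /negP mi; apply: nk; exists i.
have degm : (mdeg m < M)%N.
  have /flatten_mapP[t _] := msupp_sum_le msup.
  by move=> /msuppZ_le/msize_mdeg_lt mt; apply: leq_trans mt (szg t).
have le_m i : (m i < M)%N.
  by apply: leq_ltn_trans degm; rewrite mdegE (bigD1 i) //= leq_addr.
have [j em] : exists j : 'I_M, m = mon (Ordinal (le_m u)) j.
  (* For [u = v] the first index carries the whole exponent and the second is 0. *)
  have [uv|uv] := eqVneq u v.
    have M0 : (0 < M)%N by rewrite /M addn1.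
    exists (Ordinal M0); apply/mnmP => i; rewrite mnmDE !mulmnE !mnm1E -uv /=.
    by have [->|iu] := eqVneq i u; [lia|rewrite m0 // -uv].
  exists (Ordinal (le_m v)); apply/mnmP => i; rewrite mnmDE !mulmnE !mnm1E /=.
  have [->|iu] := eqVneq i u; first by rewrite eq_sym (negPf uv); lia.
  by have [->|iv] := eqVneq i v; [lia|rewrite m0].
have := ksum (Ordinal (le_m u), j); rewrite /= -em => sum0.
move: msup; rewrite mcoeff_msupp linear_sum /=.
rewrite (eq_bigr (fun t => k t * (g t)@_m)) ?sum0 ?eqxx // => t _.
by rewrite mcoeffZ.
Qed.

End Dependence.

(** * Monomial ideals and symbolic squares *)

Section MonomialIdeals.
Local Open Scope ring_scope.
Variables (K : fieldType) (s : nat).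
Local Notation S := {mpoly K[s]}.
Implicit Types (F : {set 'I_s}) (m : 'X_{1..s}).

Section MonIdeal.
Variable U : pred 'X_{1..s}.
Hypothesis U_up : forall m n, U m -> U (m + n)%MM.
#[local] Obligation Tactic := idtac.

Program Definition mon_ideal : ideal S :=
  @Ideal S (fun x => forall m, m \in msupp x -> U m) _ _ _.
Next Obligation. by move=> m; rewrite msupp0. Qed.
Next Obligation.
by move=> x y Ux Uy m /msuppD_le; rewrite mem_cat => /orP[/Ux|/Uy].
Qed.
Next Obligation.
move=> a x Ux m /msuppM_le/allpairsP[[m1 m2] [_ /Ux Um2 ->]].
by rewrite addmC; apply: U_up.
Qed.

Lemma mon_idealX m : mon_ideal 'X_[m] <-> U m.
Proof.
split=> [|Um n]; first by apply; rewrite msuppX inE.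
by rewrite msuppX inE => /eqP->.
Qed.

Lemma mon_ideal_min (I : ideal S) :
  (forall m, U m -> I 'X_[m]) -> forall x, mon_ideal x -> I x.
Proof.
move=> IX x Ux; rewrite [x]mpolyE big_seq; apply: ideal_sum => m xm.
by rewrite -mul_mpolyC; apply: ideal_closedM; apply: IX; apply: Ux.
Qed.

Lemma mon_idealMX x m :
  mon_ideal (x * 'X_[m]) <-> forall n, n \in msupp x -> U (m + n)%MM.
Proof.
have mem n : n \in msupp (x * 'X_[m]) <->
    exists2 k, k \in msupp x & n = (m + k)%MM.
  by rewrite (perm_mem (msuppMX x m)); split=> [/mapP|kP]; [|apply/mapP].
split=> [xX n xn|xU _ /mem[n xn ->]]; last exact: xU.
by apply: xX; apply/mem; exists n.
Qed.

End MonIdeal.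

Definition msupport m : {set 'I_s} := [set k | m k != 0%N].

(* The [d]-th power of the prime generated by the variables outside [F] is
   spanned by the monomials of degree at least [d] in these variables. *)
Definition out_deg F m : nat := (\sum_(k | k \notin F) m k)%N.

Lemma out_degD F m n : out_deg F (m + n) = (out_deg F m + out_deg F n)%N.
Proof.
by rewrite /out_deg -big_split; apply: eq_bigr => k _; rewrite mnmDE.
Qed.

Lemma mdeg_out_deg F m : mdeg m = (\sum_(k in F) m k + out_deg F m)%N.
Proof. by rewrite mdegE (bigID (mem F)). Qed.

Lemma out_deg_gt0 F m : (0 < out_deg F m)%N = ~~ (msupport m \subset F).
Proof.
rewrite lt0n /out_deg sum_nat_eq0 negb_forall; apply/existsP/subsetPn => -[k].
  by rewrite negb_imply => /andP[kF mk]; exists k; rewrite ?inE.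
by rewrite inE => mk kF; exists k; rewrite negb_imply kF.
Qed.

Lemma out_degU F k : out_deg F U_(k) = (k \notin F).
Proof.
rewrite /out_deg; have [kF|kF] := boolP (k \in F) => /=.
  apply: big1 => i iF; rewrite mnm1E; case: eqP => // ki.
  by rewrite -ki kF in iF.
rewrite (bigD1 k) //= mnm1E eqxx big1 // => i /andP[_ ik].
by rewrite mnm1E eq_sym (negPf ik).
Qed.

Lemma out_deg_up F d m n : (d <= out_deg F m)%N -> (d <= out_deg F (m + n))%N.
Proof. by rewrite out_degD => /leq_trans; apply; rewrite leq_addr. Qed.

Definition ord_ideal F d : ideal S :=
  mon_ideal (fun m n => @out_deg_up F d m n).

Lemma ord_idealM F d d' x y :
  ord_ideal F d x -> ord_ideal F d' y -> ord_ideal F (d + d') (x * y).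
Proof.
move=> Fx Fy m /msuppM_le/allpairsP[[m1 m2] [/Fx Fm1 /Fy Fm2 ->]] /=.
by rewrite out_degD leq_add.
Qed.

(** Setting the variables outside [F] to zero is an endomorphism of a domain with kernel
    [ord_ideal F 1], which makes that ideal prime. *)
Definition restrict F : S -> S :=
  mmap (@mpolyC s K) (fun k => if k \in F then 'X_k else 0).

HB.instance Definition _ F := GRing.RMorphism.on (restrict F).

Lemma restrictX F m :
  restrict F 'X_[m] = if out_deg F m == 0%N then 'X_[m] else 0.
Proof.
rewrite /restrict mmapX /mmap1; case: ifPn => [/eqP m0|].
  rewrite [RHS]mpolyXE_id; apply: eq_bigr => k _.
  case: ifPn => // kF; suff -> : m k = 0%N by rewrite !expr0.
  by apply/eqP; move/eqP: m0; rewrite sum_nat_eq0 => /forallP/(_ k); rewrite kF.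
rewrite -lt0n out_deg_gt0 => /subsetPn[k]; rewrite inE => mk kF.
by rewrite (bigD1 k) //= (negPf kF) expr0n (negPf mk) mul0r.
Qed.

Lemma restrictE F x m :
  (restrict F x)@_m = if out_deg F m == 0%N then x@_m else 0.
Proof.
have -> : restrict F x = \sum_(n <- msupp x) x@_n *: restrict F 'X_[n].
  rewrite /restrict {1}/mmap; apply: eq_bigr => n _.
  by rewrite mmapX mul_mpolyC.
rewrite linear_sum [x in RHS]mpolyE linear_sum /=.
case: ifPn => [m0|m0].
  apply: eq_bigr => n _; rewrite restrictX !mcoeffZ; case: ifPn => // n0.
  rewrite mcoeff0 mcoeffX; case: eqP => [nm|]; last by rewrite mulr0.
  by rewrite nm m0 in n0.
apply: big1 => n _; rewrite restrictX mcoeffZ; case: ifPn => n0; last first.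
  by rewrite mcoeff0 mulr0.
by rewrite mcoeffX; case: eqP => [nm|]; [rewrite -nm n0 in m0|rewrite mulr0].
Qed.

Lemma restrict_eq0 F x : restrict F x = 0 <-> ord_ideal F 1 x.
Proof.
split=> [x0 m|Fx].
  rewrite mcoeff_msupp lt0n; apply: contra => m0.
  by have := restrictE F x m; rewrite m0 x0 mcoeff0 => <-.
apply/mpolyP => m; rewrite mcoeff0 restrictE; case: ifPn => // m0.
apply/eqP; rewrite mcoeff_eq0; apply/negP => /Fx.
by rewrite lt0n m0.
Qed.

Lemma ord_ideal_prime F : prime_ideal (ord_ideal F 1).
Proof.
split=> [|x y].
  by rewrite -restrict_eq0 rmorph1 => /eqP; rewrite oner_eq0.
rewrite -!restrict_eq0 rmorphM => /eqP; rewrite mulf_eq0.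
by move=> /orP[] /eqP; [left|right].
Qed.

(** A monomial of out-degree at least 2 splits off a variable outside [F] and keeps positive
    out-degree. *)
Lemma ideal_pow2_ord F x : ideal_pow (ord_ideal F 1) 2 x <-> ord_ideal F 2 x.
Proof.
split=> [|Fx].
  apply: (@ideal_gen_min _ _ (ord_ideal F 2)) => _ [f Ff ->].
  rewrite big_ord_recl big_ord_recl big_ord0 mulr1.
  exact: (@ord_idealM F 1 1).
apply: mon_ideal_min Fx => m m2.
have pos n : (0 < out_deg F n)%N ->
    exists k n', k \notin F /\ n = (U_(k) + n')%MM.
  rewrite out_deg_gt0 => /subsetPn[k]; rewrite inE -lep1mP => kn kF.
  by exists k, (n - U_(k))%MM; rewrite addmC submK.
have [k [n [kF em]]] := pos m (ltnW m2).
have [|l [n' [lF en]]] := pos n.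
  by move: m2; rewrite em out_degD out_degU kF.
apply: ideal_gen_incl.
exists (fun i : 'I_2 => if i == 0 then 'X_k else 'X_[U_(l) + n']) => [i|].
  case: ifP => _; apply/mon_idealX; first by rewrite out_degU kF.
  by rewrite out_degD out_degU lF.
by rewrite em en mpolyXD big_ord_recl big_ord_recl big_ord0 mulr1.
Qed.

End MonomialIdeals.

(** * Edge ideals, their associated primes and symbolic squares *)

Section EdgeIdeal.
Local Open Scope ring_scope.
Variables (K : fieldType) (s : nat) (e : rel 'I_s).
Hypotheses (e_irr : irreflexive e).
Local Notation S := {mpoly K[s]}.
Implicit Types (F : {set 'I_s}) (m : 'X_{1..s}).

Lemma stableP F : reflect {in F &, forall i j, ~~ e i j} (stable e F).
Proof.
apply: (iffP forall_inP) => [st i j iF jF|st i iF].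
  by move/forall_inP: (st i iF); apply.
by apply/forall_inP => j; apply: st.
Qed.

Lemma stableS F F' : F \subset F' -> stable e F' -> stable e F.
Proof.
move=> /fintype.subsetP FF' /stableP st; apply/stableP => i j /FF' iF /FF' jF.
exact: st.
Qed.

Lemma edge_idealE (x : S) :
  edge_ideal K e x <-> forall m, m \in msupp x -> ~~ stable e (msupport m).
Proof.
have up m n : ~~ stable e (msupport m) -> ~~ stable e (msupport (m + n)%MM).
  apply: contra; apply: stableS; apply/fintype.subsetP => k; rewrite !inE mnmDE.
  by rewrite addn_eq0 negb_and => ->.
split=> [Ex|Ex].
  suff: mon_ideal K up x by [].
  apply: ideal_gen_min Ex => _ [i [j [eij ->]]].
  rewrite -mpolyXD; apply/mon_idealX/negP => /stableP/(_ i j).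
  rewrite !inE !mnmDE !mnm1E !eqxx eij addn_eq0 addn_eq0 /= andbF.
  by move=> /(_ isT isT).
apply: (@mon_ideal_min K _ _ up) Ex => m.
move=> /forall_inPn[i]; rewrite inE => mi /forall_inPn[j].
rewrite inE negbK => mj eij.
have ij : i != j by apply: contraTneq eij => ->; rewrite e_irr.
have -> : m = (U_(i) + U_(j) + (m - U_(i) - U_(j)))%MM.
  apply/mnmP => k; rewrite !mnmDE !mnmBE !mnm1E.
  have [<-|ik] := eqVneq i k; first by rewrite eq_sym (negPf ij); lia.
  have [<-|jk] := eqVneq j k; lia.
rewrite mpolyXD mulrC; apply: ideal_closedM; apply: ideal_gen_incl.
by exists i, j; rewrite mpolyXD.
Qed.

Local Notation maxstable := (maxset (stable e)).

Lemma notstable_out_deg m : ~~ stable e (msupport m) <->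
  forall F, maxstable F -> (0 < out_deg F m)%N.
Proof.
split=> [nst F /maxsetp st|out].
  by rewrite out_deg_gt0; apply: contra nst => /stableS; apply.
apply/negP => /maxset_exists[F maxF sub].
by have := out F maxF; rewrite out_deg_gt0 sub.
Qed.

(** A set of vertices is stable exactly when it lies in a maximal stable set; this is the prime
    decomposition of the edge ideal. *)
Lemma edge_ideal_bigcap (x : S) :
  edge_ideal K e x <-> forall F, maxstable F -> ord_ideal K F 1 x.
Proof.
rewrite edge_idealE; split=> [Ex F maxF m /Ex|Fx m xm].
  by move=> /notstable_out_deg; apply.
by apply/notstable_out_deg => F maxF; apply: Fx.
Qed.

Lemma ord_ideal_associated F :
  maxstable F -> associated_prime (edge_ideal K e) (ord_ideal K F 1).
Proof.
move=> maxF; split; first exact: ord_ideal_prime.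
(* The product of the variables in [F] has annihilator p_F modulo the edge ideal: by maximality of
   [F], any further variable destroys stability. *)
pose mF : 'X_{1..s} := [multinom ((k \in F) : nat) | k < s].
have msF n : msupport (mF + n)%MM = F :|: msupport n.
  apply/finset.setP => k; rewrite !inE mnmDE mnmE addn_eq0 negb_and.
  by case: (k \in F).
have up m n : ~~ stable e (msupport m) -> ~~ stable e (msupport (m + n)%MM).
  apply: contra; apply: stableS; apply/fintype.subsetP => k; rewrite !inE mnmDE.
  by rewrite addn_eq0 negb_and => ->.
exists 'X_[mF] => x; rewrite edge_idealE.
rewrite -[forall m, _]/(ideal_set (mon_ideal K up) (x * 'X_[mF])) mon_idealMX.
split=> Fx m /Fx; rewrite out_deg_gt0 msF.
  move=> /subsetPn[k km kF]; apply/negP => st.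
  have [_ /(_ _ st (finset.subsetUl _ _)) eF] := maxsetP maxF.
  by move/negP: kF; apply; rewrite -eF inE km orbT.
by apply: contra => /finset.setUidPl->; apply: maxsetp.
Qed.

(** Otherwise each p_F with [A F] has an element outside [P], and the product of their powers of
    exponent [d.+1] lies in all these p_F^(d+1), hence in [P]. *)
Lemma exists_prod_ord_ideal (P : ideal S) (A : pred {set 'I_s}) d :
  prime_ideal P ->
  (forall x, (forall F, A F -> ord_ideal K F d.+1 x) -> P x) ->
  exists2 F, A F & forall x, ord_ideal K F 1 x -> P x.
Proof.
move=> primeP AP; apply: contrapT => nF.
have /choice[g gP] : forall F, exists x : S,
    A F -> ord_ideal K F 1 x /\ ~ P x.
  move=> F; have [AF|] := boolP (A F); last by exists 0.
  have [[x xP]|nx] := pselect (exists x, ord_ideal K F 1 x /\ ~ P x).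
    by exists x.
  case: nF; exists F => // x Fx; apply: contrapT => Px; apply: nx.
  by exists x.
have [|F AF Pg] :=
    @prime_ideal_prod _ P _ (index_enum _) A (fun F => g F ^+ d.+1) primeP.
  apply: AP => F AF; rewrite (bigD1 F AF); apply: ideal_closedMr.
  have [Fg _] := gP F AF; elim: (d) => [|k IHk]; first by rewrite expr1.
  by rewrite exprS; apply: (@ord_idealM _ _ _ 1 k.+1).
by case: (gP F AF) => _; apply; apply: prime_ideal_exp primeP Pg.
Qed.

(** For P = (I(G) : f), only the [F] with [f] outside p_F matter: [P] contains the intersection of
    these p_F, hence one of them, and that p_F contains [P] because it is prime and misses [f]. *)
Lemma associated_edge_ideal (P : ideal S) :
  associated_prime (edge_ideal K e) P ->
  exists2 F, maxstable F & P = ord_ideal K F 1.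
Proof.
move=> [primeP [f Pf]].
pose A F := maxstable F && `[< ~ ord_ideal K F 1 f >].
have [x Ax|F /andP[maxF /asboolP Ff] FP] := @exists_prod_ord_ideal P A 0 primeP.
  apply/Pf/edge_ideal_bigcap => F maxF.
  have [Ff|Ff] := pselect (ord_ideal K F 1 f); first exact: ideal_closedM.
  by apply: ideal_closedMr; apply: Ax; rewrite /A maxF; apply/asboolP.
exists F => //; apply: ideal_ext; rewrite eqEsubset.
split=> [x /Pf|]; last exact: FP.
move=> /edge_ideal_bigcap/(_ F maxF); have [_ pF] := ord_ideal_prime K F.
by move=> /pF[].
Qed.

Lemma symbolic_power2E (x : S) : symbolic_power (edge_ideal K e) 2 x <->
  forall F, maxstable F -> ord_ideal K F 2 x.
Proof.
split=> [Jx F maxF|Fx P /associated_edge_ideal[F maxF ->]].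
  by apply/ideal_pow2_ord; apply: Jx; apply: ord_ideal_associated.
by apply/ideal_pow2_ord; apply: Fx.
Qed.

Lemma symbolic_power2_sub_prime (P : ideal S) : prime_ideal P ->
  (forall x, symbolic_power (edge_ideal K e) 2 x -> P x) ->
  exists2 F, maxstable F & forall x, ord_ideal K F 1 x -> P x.
Proof.
move=> primeP JP; apply: (@exists_prod_ord_ideal P _ 1) => // x Fx.
exact/JP/symbolic_power2E.
Qed.

End EdgeIdeal.

(** * A regular sequence of symmetric functions *)

Section Symmetric.
Local Open Scope ring_scope.

(** The leading coefficient of [b] is also that of [a * b], so it lies in [Q]; remove the leading
    term and iterate. Thus monic polynomials are nonzerodivisors modulo the extension of [Q]. *)
Lemma monic_mul_coef_ideal (R : comNzRingType) (Q : ideal R) (a b : {poly R}) :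
  a \is monic -> (forall i, Q (a * b)`_i) -> forall i, Q b`_i.
Proof.
move=> mona; elim: {b}(size b) {-2}b (leqnn (size b)) => [|n IHn] b szb Qab i.
  move: szb; rewrite leqn0 size_poly_eq0 => /eqP->.
  by rewrite coef0; apply: ideal_has0.
have Qn : Q b`_n.
  move: szb; rewrite leq_eqVlt => /predU1P[szb|szb]; last first.
    by rewrite nth_default //; apply: ideal_has0.
  have -> : b`_n = lead_coef b by rewrite lead_coefE szb.
  by rewrite -(lead_coef_monicM _ mona) lead_coefE; apply: Qab.
pose c := b`_n; pose b' := b - c%:P * 'X^n.
have eb : b = b' + c%:P * 'X^n by rewrite subrK.
rewrite eb coefD coefCM; apply: ideal_closedD; last exact: ideal_closedMr.
apply: IHn => [|j].
  apply/leq_sizeP => j; rewrite leq_eqVlt coefB coefCM coefXn.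
  move=> /predU1P[<-|nj].
    by rewrite eqxx mulr1 subrr.
  by rewrite (gtn_eqF nj) mulr0 subr0 nth_default // (leq_trans szb).
rewrite mulrBr coefB; apply: ideal_closedB => //.
by rewrite mulrCA coefCM; apply: ideal_closedMr.
Qed.

Lemma coef_mul1 (R : comNzRingType) (p q : {poly R}) :
  (p * q)`_1 = p`_0 * q`_1 + p`_1 * q`_0.
Proof. by rewrite coefM !big_ord_recl big_ord0 addr0. Qed.

Lemma coef_mul2 (R : comNzRingType) (p q : {poly R}) :
  (p * q)`_2 = p`_0 * q`_2 + p`_1 * q`_1 + p`_2 * q`_0.
Proof. by rewrite coefM !big_ord_recl big_ord0 addr0 addrA. Qed.

Section SymmetricFunctions.
Variables (R : comNzRingType) (I : finType) (z : I -> R).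

(* The coefficients of degree 1 and 2 are the first two elementary symmetric
   functions of the [z k]. *)
Definition sym_poly (A : pred I) : {poly R} :=
  \prod_(k | A k) (1 + (z k)%:P * 'X).

Lemma coef_factor k i :
  (1 + (z k)%:P * 'X)`_i = (i == 0)%:R + (i == 1%N)%:R * z k.
Proof. by rewrite coefD coef1 coefCM coefX mulrC. Qed.

(** [P1] and [P2] serve as the first and second power of a prime, as one ideal twice, or as freeness
    from a variable; with [setT] only the constant term is extracted. *)
Lemma sym_polyP (A : pred I) (P1 P2 : R -> Prop) :
  P1 0 -> (forall x y, P1 x -> P1 y -> P1 (x + y)) ->
  P2 0 -> (forall x y, P2 x -> P2 y -> P2 (x + y)) ->
  (forall x y, P1 x -> P1 y -> P2 (x * y)) ->
  (forall k, A k -> P1 (z k)) ->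
  [/\ (sym_poly A)`_0 = 1, P1 (sym_poly A)`_1 & P2 (sym_poly A)`_2].
Proof.
move=> P10 P1D P20 P2D P1M P1z; rewrite /sym_poly.
elim/big_ind: _ => [|p q [p0 p1 p2] [q0 q1 q2]|k Ak].
- by rewrite !coef1.
- rewrite coef0M coef_mul1 coef_mul2 p0 q0 !mul1r !mulr1; split=> //.
    exact: P1D.
  by apply: (P2D) => //; apply: (P2D) => //; apply: P1M.
- by rewrite !coef_factor /= !mul0r mul1r !addr0 add0r; split=> //; apply: P1z.
Qed.

Lemma sym_polyD1 (A : pred I) u : A u ->
  (sym_poly A)`_1 = z u + (sym_poly (fun k => A k && (k != u)))`_1.
Proof.
move=> Au; rewrite {1}/sym_poly (bigD1 u) //= coef_mul1 !coef_factor /=.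
have [//|//|//|//|//|//|-> _ _] :=
  @sym_polyP (fun k => A k && (k != u)) setT setT.
by rewrite -/(sym_poly _); ring.
Qed.

Lemma sym_polyD2 u v : u != v ->
  let r := sym_poly (fun k => (k != u) && (k != v)) in
  (sym_poly xpredT)`_1 = z u + z v + r`_1 /\
  (sym_poly xpredT)`_2 = z u * z v + (z u + z v) * r`_1 + r`_2.
Proof.
move=> uv r.
have [//|//|//|//|//|//|r0 _ _] :=
  @sym_polyP (fun k => (k != u) && (k != v)) setT setT.
rewrite /sym_poly (bigD1 u) //= (bigD1 v) /= 1?eq_sym // -/(sym_poly _) -/r.
rewrite !(coef_mul1, coef_mul2, coef0M) !coef_factor /= r0.
by split; ring.
Qed.

End SymmetricFunctions.

End Symmetric.

(** * Nonzerodivisors that are monic in one variable *)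

Section Regular.
Local Open Scope ring_scope.
Variables (K : fieldType) (s : nat).
Local Notation S := {mpoly K[s]}.
Implicit Types (u v k : 'I_s) (Q : ideal S).

(** An element of [S] seen as a polynomial in t_u. The coefficients do not involve t_u but are kept
    in [S], which avoids a change of ring. *)
Definition as_poly u : S -> {poly S} :=
  mmap (polyC \o @mpolyC s K) (fun k => if k == u then 'X else ('X_k)%:P).

HB.instance Definition _ u := GRing.RMorphism.on (as_poly u).

Lemma as_polyC u c : as_poly u c%:MP = c%:MP%:P.
Proof. by rewrite /as_poly /= mmapC. Qed.

Lemma as_polyXU u k : as_poly u 'X_k = if k == u then 'X else ('X_k)%:P.
Proof. by rewrite /as_poly /= mmapX mmap1U. Qed.

Lemma as_polyK u b : (as_poly u b).['X_u] = b.
Proof.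
elim/mpoly_ring_ind: b => [c|k|p q Hp Hq|p q Hp Hq].
- by rewrite as_polyC hornerC.
- by rewrite as_polyXU; case: eqP => [->|_]; rewrite ?hornerX ?hornerC.
- by rewrite rmorphD hornerD /= {1}Hp {1}Hq.
- by rewrite rmorphM hornerM /= {1}Hp {1}Hq.
Qed.

Definition mnm_drop u (m : 'X_{1..s}) : 'X_{1..s} :=
  [multinom (if k == u then 0%N else m k) | k < s].

Lemma as_polyX u m : as_poly u 'X_[m] = ('X_[mnm_drop u m])%:P * 'X^(m u).
Proof.
have -> : 'X_[mnm_drop u m] = \prod_(k | k != u) 'X_k ^+ m k :> S.
  rewrite mpolyXE_id (bigD1 u) //= mnmE eqxx expr0 mul1r.
  by apply: eq_bigr => k ku; rewrite mnmE (negPf ku).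
rewrite mpolyXE_id !rmorph_prod (bigD1 u) //= mulrC; congr (_ * _); last first.
  by rewrite rmorphXn /= as_polyXU eqxx.
by apply: eq_bigr => k ku; rewrite !rmorphXn /= as_polyXU (negPf ku).
Qed.

(* [Q] is generated by elements that do not involve ['X_u]. *)
Definition extended u Q := forall b, Q b -> forall i, Q (as_poly u b)`_i.

(** Cancel the monic [as_poly u a] coefficientwise, then substitute ['X_u] back. *)
Lemma extended_nzd u Q a b :
  extended u Q -> as_poly u a \is monic -> Q (a * b) -> Q b.
Proof.
move=> extQ mona Qab; rewrite -(as_polyK u b) horner_coef.
apply: ideal_sum => i _; apply: ideal_closedMr.
by apply: monic_mul_coef_ideal mona _ _ => j; rewrite -rmorphM; apply: extQ.
Qed.

Lemma extended_mon u (U : pred 'X_{1..s})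
    (up : forall m n, U m -> U (m + n)%MM) :
  (forall m, U m -> U (mnm_drop u m)) -> extended u (mon_ideal K up).
Proof.
move=> Udrop b Ub i; rewrite [b]mpolyE rmorph_sum coef_sum big_seq.
apply: ideal_sum => m /Ub Um; rewrite -mul_mpolyC rmorphM /= as_polyC as_polyX.
rewrite !coefCM mulrCA; apply: (@ideal_closedMr _ (mon_ideal K up)).
by apply/mon_idealX; apply: Udrop.
Qed.

Lemma out_deg_drop u (F : {set 'I_s}) m :
  u \in F -> out_deg F (mnm_drop u m) = out_deg F m.
Proof.
move=> uF; apply: eq_bigr => k kF; rewrite mnmE; case: eqP kF => // ->.
by rewrite uF.
Qed.

Lemma extended_ord u (F : {set 'I_s}) d :
  u \in F -> extended u (ord_ideal K F d).
Proof. by move=> uF; apply: extended_mon => m; rewrite out_deg_drop. Qed.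

Lemma extended_adjoin u Q x :
  extended u Q -> as_poly u x = x%:P -> extended u (ideal_adjoin Q x).
Proof.
move=> extQ fixx b [c Qbc] i; exists (as_poly u c)`_i.
by rewrite -coefMC -fixx -rmorphM -coefB -rmorphB; apply: extQ.
Qed.

Section Thetas.
Variable q : {poly K}.
Hypothesis monq : q \is monic.

(** The factor ['X] puts [param k] into every ideal containing t_k; [q] monic makes it monic in
    t_k. *)
Definition param k : S := eval_at (@mpolyC s K) 'X_k ('X * q).

Lemma paramE k : param k = 'X_k * eval_at (@mpolyC s K) 'X_k q.
Proof. by rewrite /param rmorphM /= horner_morphX. Qed.

Lemma as_poly_param u k : as_poly u (param k) =
  if k == u then map_poly (@mpolyC s K) ('X * q) else (param k)%:P.
Proof.
rewrite /param !(eval_atE _ _ (leqnn _)) rmorph_sum.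
case: ifPn => [/eqP->|ku]; last first.
  rewrite rmorph_sum; apply: eq_bigr => i _.
  by rewrite !rmorphM !rmorphXn /= as_polyC as_polyXU (negPf ku).
rewrite /map_poly poly_def; apply: eq_bigr => i _.
by rewrite rmorphM rmorphXn /= as_polyC as_polyXU eqxx mul_polyC.
Qed.

Lemma monic_as_poly_param u c : as_poly u c = c%:P ->
  as_poly u (param u + c) \is monic.
Proof.
move=> fixc; rewrite rmorphD /= as_poly_param eqxx fixc.
set p := map_poly _ _.
have monp : p \is monic by apply: monic_map; rewrite monicMr // monicX.
have szp : (1 < size p)%N.
  rewrite size_map_poly mulrC size_mulX ?monic_neq0 //.
  by rewrite ltnS size_poly_gt0 monic_neq0.
rewrite monicE lead_coefDl; first by rewrite -monicE.
exact: leq_ltn_trans (size_polyC_leq1 _) szp.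
Qed.

Lemma param_ord k (F : {set 'I_s}) : k \notin F -> ord_ideal K F 1 (param k).
Proof.
move=> kF; rewrite paramE; apply: ideal_closedMr; apply/mon_idealX.
by rewrite out_degU kF.
Qed.

Lemma as_poly_sym u (A : pred 'I_s) : (forall k, A k -> k != u) ->
  as_poly u (sym_poly param A)`_1 = ((sym_poly param A)`_1)%:P.
Proof.
move=> Au; pose P x := as_poly u x = x%:P.
have [|||||k /Au ku|_ //] := @sym_polyP _ _ param A P setT.
- by rewrite /P rmorph0.
- by move=> x y; rewrite /P rmorphD /= polyCD => -> ->.
- by [].
- by [].
- by [].
by rewrite /P as_poly_param (negPf ku).
Qed.

Definition theta1 : S := (sym_poly param xpredT)`_1.
Definition theta2 : S := (sym_poly param xpredT)`_2.

Lemma theta_ideal Q : (forall k, Q (param k)) -> Q theta1 /\ Q theta2.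
Proof.
move=> Qp; have [|||||//|] := @sym_polyP _ _ param xpredT Q Q.
- exact: ideal_has0.
- by move=> x y; apply: ideal_closedD.
- exact: ideal_has0.
- by move=> x y; apply: ideal_closedD.
- by move=> x y Qx Qy; apply: ideal_closedM.
by [].
Qed.

(** [theta1] is [param u] plus terms free of t_u, hence monic in t_u. *)
Lemma theta1_nzd u Q b : extended u Q -> Q (theta1 * b) -> Q b.
Proof.
move=> extQ; apply: extended_nzd extQ _.
rewrite /theta1 (sym_polyD1 _ (u := u)) //.
by apply: monic_as_poly_param; apply: as_poly_sym => k /andP[].
Qed.

Lemma param_nzd u Q b : extended u Q -> Q (param u * b) -> Q b.
Proof.
move=> extQ; apply: extended_nzd extQ _; rewrite -[param u]addr0.
by apply: monic_as_poly_param; rewrite !rmorph0.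
Qed.

(* Modulo the ideal, theta1 = z + w + h and theta2 = z * w + h * theta1 with
   h ^+ 2 = 0, so theta2 may be replaced by the product z * w. *)
Lemma theta2_nzd u v (F : {set 'I_s}) a b : u != v -> u \in F -> v \in F ->
  (forall k, k \in F -> (k == u) || (k == v)) ->
  ord_ideal K F 2 (theta2 * a - theta1 * b) ->
  exists c, ord_ideal K F 2 (a - theta1 * c).
Proof.
move=> uv uF vF Fuv Qab; set Q := ord_ideal K F 2 in Qab *.
pose A k := (k != u) && (k != v).
pose h := (sym_poly param A)`_1.
have [_ Fh Qr] : [/\ (sym_poly param A)`_0 = 1, ord_ideal K F 1 h
    & Q (sym_poly param A)`_2].
  apply: sym_polyP => [|x y|||x y|k].
  - exact: ideal_has0.
  - exact: ideal_closedD.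
  - exact: ideal_has0.
  - by move=> x y; apply: ideal_closedD.
  - exact: (@ord_idealM _ _ _ 1 1).
  - by rewrite /A -negb_or => /(contra (Fuv k)) kF; apply: param_ord.
have [e1 e2] := sym_polyD2 param uv.
rewrite -/A -/h -/theta1 -/theta2 in e1 e2 *.
have Qhh : Q (h * h) by apply: (@ord_idealM _ _ _ 1 1).
have hu : as_poly u h = h%:P by apply: as_poly_sym => k /andP[].
have hv : as_poly v h = h%:P by apply: as_poly_sym => k /andP[].
set z := param u in e1 e2 *; set w := param v in e1 e2 *.
have zv : as_poly v z = z%:P by rewrite as_poly_param (negPf uv).
have wu : as_poly u w = w%:P by rewrite as_poly_param eq_sym (negPf uv).
have extu : extended u Q := extended_ord uF.
have extv : extended v Q := extended_ord vF.
have {Qab} Qab : Q (z * w * a - theta1 * (b - h * a)).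
  have -> : z * w * a - theta1 * (b - h * a) = (theta2 * a - theta1 * b)
      - (sym_poly param A)`_2 * a + h * h * a by rewrite e2 e1; ring.
  apply: ideal_closedD; last exact: ideal_closedMr.
  by apply: ideal_closedB => //; apply: ideal_closedMr.
move: (b - h * a) => {}b in Qab.
(* Modulo [z] the relation reads (w + h) b = 0, and w + h is monic in t_v. *)
have [c Qc] : ideal_adjoin Q z b.
  apply: (@extended_nzd v _ (w + h)); first exact: extended_adjoin.
    exact: monic_as_poly_param.
  exists (w * a - b).
  have -> : (w + h) * b - (w * a - b) * z = - (z * w * a - theta1 * b).
    by rewrite e1; ring.
  exact: ideal_closedN.
(* Substitute [c * z] for [b] and cancel [z]; the same argument with [z] and [w] exchanged
   follows. *)
have {b Qab Qc} Qac : Q (w * a - theta1 * c).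
  apply: (@param_nzd u) => //.
  have -> : param u * (w * a - theta1 * c) = (z * w * a - theta1 * b)
    + theta1 * (b - c * z) by rewrite /z; ring.
  by apply: ideal_closedD => //; apply: ideal_closedM.
have [d Qd] : ideal_adjoin Q w c.
  apply: (@extended_nzd u _ (z + h)); first exact: extended_adjoin.
    exact: monic_as_poly_param.
  exists (a - c).
  have -> : (z + h) * c - (a - c) * w = - (w * a - theta1 * c).
    by rewrite e1; ring.
  exact: ideal_closedN.
exists d; apply: (@param_nzd v) => //.
have -> : param v * (a - theta1 * d) = (w * a - theta1 * c)
  + theta1 * (c - d * w) by rewrite /w; ring.
by apply: ideal_closedD => //; apply: ideal_closedM.
Qed.

End Thetas.
End Regular.

(** * Edge-critical graphs of independence number 2 *)

Section Graph.
Variables (s : nat) (e : rel 'I_s).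
Hypotheses (e_sym : ssrbool.symmetric e) (e_irr : irreflexive e).
Hypothesis ind2 : independence_number e = 2.
Implicit Types (F A : {set 'I_s}) (i j k : 'I_s).

Local Notation maxstable := (maxset (stable e)).

Lemma stable_card A : stable e A -> #|A| <= 2.
Proof.
by move=> stA; rewrite -ind2 /independence_number (bigmax_sup A).
Qed.

Lemma stable1 i : stable e [set i].
Proof.
by apply/stableP => j k; rewrite !inE => /eqP-> /eqP->; rewrite e_irr.
Qed.

Lemma stable2 i j : ~~ e i j -> stable e [set i; j].
Proof.
move=> eij; apply/stableP => k l; rewrite !inE.
by move=> /orP[] /eqP-> /orP[] /eqP->; rewrite ?e_irr // e_sym.
Qed.

Lemma exists_stable2 : exists2 A, stable e A & #|A| = 2.
Proof.
have st0 : stable e finset.set0 by apply/stableP => i; rewrite inE.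
have [|A stA maxA] := @eq_bigmax_cond _ (stable e) (fun A : {set 'I_s} => #|A|).
  by apply/card_gt0P; exists finset.set0.
by exists A => //; rewrite -maxA.
Qed.

(** A stable set of three vertices that appears on removing the edge must contain both its ends,
    since [e] has no stable set of this size; the third vertex is [k]. *)
Lemma critical_edgeP i j : critical_edge e i j <->
  e i j /\ exists k, [/\ k != i, k != j, ~~ e i k & ~~ e j k].
Proof.
rewrite /critical_edge ind2.
split=> [[eij ltind]|[eij [k [ki kj eik ejk]]]]; split=> //.
  have st0 : stable (remove_edge e i j) finset.set0.
    by apply/stableP => k; rewrite inE.
  have [|A stA maxA] := @eq_bigmax_cond _ (stable (remove_edge e i j))
      (fun A : {set 'I_s} => #|A|).
    by apply/card_gt0P; exists finset.set0.
  have ltA : 2 < #|A| by rewrite -maxA.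
  move/stableP: stA => stA.
  have eA x y : x \in A -> y \in A ->
      [set x; y]%SET != [set i; j]%SET -> ~~ e x y.
    by move=> xA yA /negPf neq; have := stA x y xA yA; case/nandP; rewrite ?neq.
  have [iA jA] : i \in A /\ j \in A.
    have nst : ~~ stable e A by apply/negP => /stable_card; rewrite leqNgt ltA.
    have [x xA /forall_inPn[y yA]] := forall_inPn nst; rewrite negbK => exy.
    have /eqP eqxy : [set x; y]%SET == [set i; j]%SET.
      by apply: contraTT exy; apply: eA.
    have sub : [set i; j]%SET \subset A.
      by rewrite -eqxy finset.subUset !finset.sub1set xA.
    by move: sub; rewrite finset.subUset !finset.sub1set => /andP[].
  have [k] : exists k, k \in A :\ i :\ j.
    apply/card_gt0P; move: ltA; rewrite (cardsD1 i A) iA (cardsD1 j (A :\ i)).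
    by case: (j \in _) => /=; rewrite ?add0n !add1n !ltnS // => /ltnW.
  rewrite !inE => /and3P[kj ki kA]; exists k; split=> //; apply: eA => //.
    apply: contraNneq kj => eqS.
    have : j \in [set i; j]%SET by rewrite !inE eqxx orbT.
    rewrite -eqS !inE => /orP[] /eqP // ji; last by rewrite ji.
    by rewrite -ji e_irr in eij *.
  apply: contraNneq ki => eqS; have : i \in [set i; j]%SET by rewrite !inE eqxx.
  rewrite -eqS !inE => /orP[] /eqP // ij; last by rewrite ij.
  by rewrite -ij e_irr in eij *.
have ij : i != j by apply: contraTneq eij => ->; rewrite e_irr.
have st : stable (remove_edge e i j) [set i; j; k].
  apply/stableP => x y; rewrite !inE /= negb_and negbK.
  move=> /orP[/orP[]|] /eqP-> /orP[/orP[]|] /eqP->;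
    rewrite ?e_irr ?eqxx ?orbT ?eik ?ejk //.
  - by rewrite finset.setUC eqxx orbT.
  - by rewrite e_sym eik.
  - by rewrite e_sym ejk.
apply: leq_trans (leq_bigmax_cond (F := fun A : {set 'I_s} => #|A|) _ st).
by rewrite -finset.setUA cardsU1 cards2 !inE negb_or ij eq_sym ki eq_sym kj.
Qed.

Lemma maxstable_exists i : exists2 F, maxstable F & i \in F.
Proof.
have [F maxF] := maxset_exists (stable1 i).
by rewrite finset.sub1set; exists F.
Qed.

Lemma maxstable_pair i j : i != j -> ~~ e i j -> maxstable [set i; j].
Proof.
move=> ij eij; apply/maxsetP; split; first exact: stable2.
move=> B /stable_card cardB sub; apply/eqP; rewrite eq_sym eqEcard sub.
by rewrite cards2 ij.
Qed.

Lemma maxstable_neq0 F : maxstable F -> exists i, i \in F.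
Proof.
move=> maxF; have [A _ cardA] := exists_stable2.
have [i _] : exists i, i \in A by apply/card_gt0P; rewrite cardA.
have [F0|/set0Pn //] := eqVneq F finset.set0; rewrite F0 in maxF.
have [_ /(_ [set i] (stable1 i) (finset.sub0set _)) eF] := maxsetP maxF.
by exists i; rewrite F0 -eF inE.
Qed.

(** Without edge-criticality [F] may be a single vertex; then [u = v]. *)
Lemma maxstable_sub2 F : maxstable F ->
  exists u v, forall k, k \in F -> (k == u) || (k == v).
Proof.
move=> maxF; have [i iF] := maxstable_neq0 maxF.
have := stable_card (maxsetp maxF); rewrite (cardsD1 i) iF ltnS.
have [F0 _|[j]] := set_0Vmem (F :\ i).
  exists i, i => k kF; rewrite orbb; apply: contraT => ki.
  have : k \in F :\ i by rewrite !inE ki.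
  by rewrite F0 inE.
move=> jF; rewrite (cardsD1 j) jF ltnS leqn0 cards_eq0 => /eqP F0.
exists i, j => k kF; apply: contraT; rewrite negb_or => /andP[ki kj].
have : k \in F :\ i :\ j by rewrite !inE ki kj.
by rewrite F0 inE.
Qed.

Lemma edge_critical_common i j : edge_critical e -> e i j ->
  exists k, [/\ k != i, k != j, ~~ e i k & ~~ e j k].
Proof. by move=> crit eij; have /critical_edgeP[] := crit i j eij. Qed.

(** If {i} were maximal, [i] would be adjacent to all other vertices, and an edge at [i] would have
    no common non-neighbour of its ends. *)
Lemma edge_critical_maxstable F : edge_critical e -> maxstable F ->
  exists u v, [/\ u != v, ~~ e u v & F = [set u; v]].
Proof.
move=> crit maxF; have stF := maxsetp maxF.
have cardF : #|F| == 2.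
  rewrite eqn_leq stable_card //= ltnNge; apply/negP => cardF.
  have [i iF] := maxstable_neq0 maxF.
  have eF : F = [set i].
    by apply/eqP; rewrite eq_sym eqEcard finset.sub1set iF cards1.
  have [A _ cardA] := exists_stable2.
  have [j] : exists j, j \in A :\ i.
    apply/card_gt0P; move: cardA; rewrite (cardsD1 i A).
    by case: (i \in A); rewrite ?add1n ?add0n; [case=> ->|move=> ->].
  rewrite !inE => /andP[ji _].
  have contra k : k != i -> ~~ e i k -> False.
    move=> ki eik.
    have [_ /(_ _ (stable2 eik))] := maxsetP maxF.
    rewrite eF finset.subsetUl => /(_ isT)/finset.setP/(_ k).
    by rewrite !inE eqxx orbT (negPf ki).
  have [eij|] := boolP (e i j); last exact: contra ji.
  have [k [ki _ eik _]] := edge_critical_common crit eij.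
  exact: contra ki eik.
have /cards2P[u [v [uv eF]]] := cardF; exists u, v; split=> //.
by move/stableP: stF; apply; rewrite eF !inE eqxx ?orbT.
Qed.

(* Since [mdeg m - m p] bounds [out_deg F m] for every [F] containing [p], an
   [m] of out-degree at most 1 for two disjoint edges of the complement graph
   also has out-degree at most 1 for the edges of a path joining them. *)
Lemma edge_critical_glue (T : Type) (val : {set 'I_s} -> T) (m : 'X_{1..s}) :
  edge_critical e ->
  (forall F F' u, maxstable F -> maxstable F' -> u \in F -> u \in F' ->
     out_deg F m <= 1 -> out_deg F' m <= 1 -> val F = val F') ->
  forall F F', maxstable F -> maxstable F' ->
     out_deg F m <= 1 -> out_deg F' m <= 1 -> val F = val F'.
Proof.
move=> crit share F F' maxF maxF' outF outF'.
have [/set0Pn[u]|] := boolP (F :&: F' != finset.set0).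
  by rewrite inE => /andP[uF uF']; apply: (share F F' u).
rewrite negbK setI_eq0 => dis.
(* The two vertices of [A] lie outside [B], so their exponents sum to at most 1, and one vertex [p]
   carries all of [m] within [A]. *)
have pivot (A B : {set 'I_s}) :
    maxstable A -> [disjoint A & B] -> out_deg B m <= 1 ->
    exists2 p, p \in A & out_deg A m + m p = mdeg m.
  move=> maxA disAB outB.
  have [u [v [uv _ eA]]] := edge_critical_maxstable crit maxA.
  have uvB : m u + m v <= 1.
    apply: leq_trans outB; rewrite /out_deg (bigD1 u) /=; last first.
      by rewrite (disjointFr disAB) // eA !inE eqxx.
    rewrite leq_add2l (bigD1 v) /= ?leq_addr // eq_sym uv andbT.
    by rewrite (disjointFr disAB) // eA !inE eqxx orbT.
  have sumA : (\sum_(k in A) m k = m u + m v)%N.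
    by rewrite eA big_setU1 ?inE //= big_set1.
  have [mu|mu] := eqVneq (m u) 0%N.
    by exists v; rewrite ?eA ?inE ?eqxx ?orbT // (mdeg_out_deg A) sumA -eA; lia.
  by exists u; rewrite ?eA ?inE ?eqxx // (mdeg_out_deg A) sumA -eA; lia.
have out (A B : {set 'I_s}) p : out_deg A m + m p = mdeg m -> p \in B ->
    out_deg A m <= 1 -> out_deg B m <= 1.
  move=> Ap pB; apply: leq_trans; rewrite -(leq_add2r (m p)) Ap.
  by rewrite (mdeg_out_deg B) addnC leq_add2r (bigD1 p) //= leq_addr.
have [p pF mp] := pivot F F' maxF dis outF'.
have [p' pF' mp'] : exists2 p, p \in F' & out_deg F' m + m p = mdeg m.
  by apply: (pivot F' F) => //; rewrite disjoint_sym.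
have pp' : p != p'.
  by apply: contraTneq pF => ->; rewrite (disjointFl dis).
have in1 (x y : 'I_s) : x \in [set x; y]%SET by rewrite !inE eqxx.
have in2 (x y : 'I_s) : y \in [set x; y]%SET by rewrite !inE eqxx orbT.
have [epp'|epp'] := boolP (e p p'); last first.
  have maxE := maxstable_pair pp' epp'.
  have outE := out _ _ _ mp (in1 p p') outF.
  transitivity (val [set p; p']%SET).
    exact: share _ _ _ maxF maxE pF (in1 _ _) outF outE.
  exact: share _ _ _ maxE maxF' (in2 _ _) pF' outE outF'.
have [k [kp kp' epk ep'k]] := edge_critical_common crit epp'.
rewrite eq_sym in kp; rewrite eq_sym in kp'.
have maxE := maxstable_pair kp epk; have outE := out _ _ _ mp (in1 p k) outF.
have maxE' := maxstable_pair kp' ep'k.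
have outE' := out _ _ _ mp' (in1 p' k) outF'.
transitivity (val [set p; k]%SET).
  exact: share _ _ _ maxF maxE pF (in1 _ _) outF outE.
transitivity (val [set p'; k]%SET).
  exact: share _ _ _ maxE maxE' (in2 _ _) (in2 _ _) outE outE'.
exact: share _ _ _ maxE' maxF' (in1 _ _) pF' outE' outF'.
Qed.

End Graph.

(** * The Cohen-Macaulay property *)

Section Algebraic.
Local Open Scope ring_scope.
Variables (K : fieldType) (s : nat).
Local Notation S := {mpoly K[s]}.

(** All other variables vanish modulo [m], so bivariate polynomials map onto the field S / m, and
    the kernel contains a nonzero polynomial in the inner variable alone. *)
Lemma variable_algebraic (m : ideal S) (u v : 'I_s) : maximal_ideal m ->
  (forall k, k != u -> k != v -> m 'X_k) ->
  exists2 q : {poly K}, q != 0 & m (eval_at (@mpolyC s K) 'X_u q).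
Proof.
move=> maxm mX; pose phi := eval_at (eval_at (@mpolyC s K) 'X_u) 'X_v.
have phiS a : exists b, m (a - phi b).
  elim/mpoly_ring_ind: a => [c|k|p q [b mb] [b' mb']|p q [b mb] [b' mb']].
  - exists c%:P%:P; rewrite /phi /= !horner_morphC /= horner_morphC subrr.
    exact: ideal_has0.
  - have [->|ku] := eqVneq k u.
      exists 'X%:P; rewrite /phi /= horner_morphC /= horner_morphX subrr.
      exact: ideal_has0.
    have [->|kv] := eqVneq k v.
      by exists 'X; rewrite /phi /= horner_morphX subrr; apply: ideal_has0.
    by exists 0; rewrite rmorph0 subr0; apply: mX.
  - exists (b + b'); rewrite rmorphD opprD addrACA.
    exact: ideal_closedD.
  exists (b * b'); rewrite rmorphM.
  have -> : p * q - phi b * phi b' = (p - phi b) * q + phi b * (q - phi b').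
    by ring.
  by apply: ideal_closedD; [apply: ideal_closedMr|apply: ideal_closedM].
have [||q q0 mq] := @maximal_bivariate_const K (contraction phi m).
- by rewrite /= rmorph1; case: maxm.
- move=> x /(maximal_ideal_inv maxm)[a ma]; have [b mb] := phiS a.
  exists b; suff: m (phi b * phi x - 1) by rewrite /= rmorphB rmorphM rmorph1.
  have -> : phi b * phi x - 1 = (a * phi x - 1) - (a - phi b) * phi x by ring.
  by apply: ideal_closedB => //; apply: ideal_closedMr.
exists q => //; move: mq; rewrite /= /phi.
by rewrite /= horner_morphC.
Qed.

(** The normalized product of polynomials annihilating t_u and t_v serves both; for the other
    variables the factor t_k of [param q k] suffices. *)
Lemma exists_param_maximal (m : ideal S) (u v : 'I_s) : maximal_ideal m ->
  (forall k, k != u -> k != v -> m 'X_k) ->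
  exists2 q : {poly K}, q \is monic & forall k, m (param q k).
Proof.
move=> maxm mX.
have [p p0 mp] := variable_algebraic maxm mX.
have [|r r0 mr] := @variable_algebraic m v u maxm.
  by move=> k kv ku; apply: mX.
pose c := (lead_coef (p * r))^-1.
have c0 : c != 0 by rewrite invr_eq0 lead_coef_eq0 mulf_neq0.
exists (c%:P * (p * r)) => [|k].
  by rewrite mul_polyC monicE lead_coefZ mulVf // lead_coef_eq0 mulf_neq0.
rewrite paramE; have [->|ku] := eqVneq k u.
  by rewrite !rmorphM; do 2!apply: ideal_closedM; apply: ideal_closedMr.
have [->|kv] := eqVneq k v.
  by rewrite !rmorphM; do 3!apply: ideal_closedM.
by apply: ideal_closedMr; apply: mX.
Qed.

End Algebraic.

Section Criterion.
Local Open Scope ring_scope.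
Variables (K : fieldType) (s : nat) (e : rel 'I_s).
Hypotheses (e_sym : ssrbool.symmetric e) (e_irr : irreflexive e).
Hypothesis ind2 : independence_number e = 2%N.
Local Notation S := {mpoly K[s]}.
Local Notation J := (symbolic_power (edge_ideal K e) 2).
Local Notation maxstable := (maxset (stable e)).
Implicit Types (F A : {set 'I_s}) (i j k : 'I_s).

(** In a longer chain pick an element of each of the first three differences. They are dependent
    modulo a p_F contained in [P 0], which [dependence_no_chain] excludes. *)
Lemma symbolic_power2_dim n (P : nat -> ideal S) :
  prime_chain n P -> (forall x, J x -> P 0%N x) -> (n <= 2)%N.
Proof.
move=> chainP JP; rewrite leqNgt; apply/negP => lt2n.
have [primeP ltP] := chainP.
have chain3 : prime_chain 3 P.
  split=> i lei; first by apply: primeP; apply: leq_trans lei lt2n.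
  by apply: ltP; apply: leq_trans lei lt2n.
have [F maxF FP] := symbolic_power2_sub_prime e_irr (primeP 0%N isT) JP.
have [u [v Fuv]] := maxstable_sub2 e_irr ind2 maxF.
have pick (i : nat) : (i < n)%N -> exists f, ~ P i f /\ P i.+1 f.
  move=> /ltP[_ nsub]; apply: contrapT => nf; apply: nsub => f Pf.
  by apply: contrapT => nPf; apply: nf; exists f.
have [f0 [n0 h0]] := pick 0%N (leq_trans (isT : (0 < 3)%N) lt2n).
have [f1 [n1 h1]] := pick 1%N (leq_trans (isT : (1 < 3)%N) lt2n).
have [f2 [n2 h2]] := pick 2%N lt2n.
have [q q0 qP] := mpoly_dependence3 u v f0 f1 f2.
apply: (@dependence_no_chain _ _ (@mpolyC s K) f0 f1 f2 P q q0 _ chain3)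
  => [c c0||//|//].
  by exists (c^-1)%:MP; rewrite /= -mpolyCM mulVf.
apply: FP => m /qP[k [ku kv mk]]; rewrite out_deg_gt0.
apply/subsetPn; exists k; first by rewrite inE.
by apply: contra ku => /Fuv; rewrite (negPf kv) orbF.
Qed.

(** * From edge-critical to Cohen-Macaulay *)

Section Sufficiency.
Hypothesis crit : edge_critical e.

Lemma symbolic_power2_theta1_nzd (q : {poly K}) (a : S) :
  q \is monic -> J (theta1 s q * a) -> J a.
Proof.
move=> monq /(symbolic_power2E e_irr _) Ja; apply/(symbolic_power2E e_irr _).
move=> F maxF; have [u uF] := maxstable_neq0 e_irr ind2 maxF.
have extQ : extended u (ord_ideal K F 2) := extended_ord uF.
apply: (theta1_nzd monq extQ); exact: Ja.
Qed.

Lemma symbolic_power2_theta2_nzd (q : {poly K}) (a b : S) : q \is monic ->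
  J (theta2 s q * a - theta1 s q * b) -> exists c, J (a - theta1 s q * c).
Proof.
move=> monq /(symbolic_power2E e_irr _) Jab.
set f := theta1 s q in Jab *.
have /choice[c cP] : forall F, exists c,
    maxstable F -> ord_ideal K F 2 (a - f * c).
  move=> F; have [maxF|] := boolP (maxstable F); last by exists 0.
  have [u [v [uv _ eF]]] := edge_critical_maxstable e_sym e_irr ind2 crit maxF.
  have [||k|//|c cP] := @theta2_nzd K s q monq u v F a b uv.
  - by rewrite eF !inE eqxx.
  - by rewrite eF !inE eqxx orbT.
  - by rewrite eF !inE.
  - exact: Jab.
  by exists c.
have same m F F' : maxstable F -> maxstable F' ->
    (out_deg F m <= 1)%N -> (out_deg F' m <= 1)%N -> (c F)@_m = (c F')@_m.
  move: F F'; apply: (edge_critical_glue e_sym e_irr ind2 crit).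
  move=> F F' u maxF maxF' uF uF' outF outF'.
  pose U m := (2 <= out_deg F m)%N || (2 <= out_deg F' m)%N.
  have up m1 m2 : U m1 -> U (m1 + m2)%MM.
    by move=> /orP[Um|Um]; apply/orP; [left|right]; apply: out_deg_up.
  have extU : extended u (mon_ideal K up).
    by apply: extended_mon => m1; rewrite /U !out_deg_drop.
  have : mon_ideal K up (c F - c F').
    apply: (theta1_nzd monq extU).
    have -> : theta1 s q * (c F - c F') = (a - f * c F') - (a - f * c F).
      by rewrite -/f; ring.
    apply: ideal_closedB => m1.
      by move=> /(cP F' maxF') m1F'; rewrite /U m1F' orbT.
    by move=> /(cP F maxF) m1F; rewrite /U m1F.
  move=> /(_ m) Um; apply/eqP; rewrite -subr_eq0 -mcoeffB mcoeff_eq0.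
  by apply/negP => /Um; rewrite /U !ltnNge outF outF'.
pose good m F := maxstable F && (out_deg F m <= 1)%N.
(* If no [F] is good for [m], the monomial lies in every p_F^2 and the default 0 is harmless. *)
pose val m := if [pick F | good m F] is Some F then (c F)@_m else 0.
have valE m F : good m F -> val m = (c F)@_m.
  move=> /andP[maxF outF]; rewrite /val; case: pickP => [F' /andP[]|/(_ F)].
    by move=> maxF' outF'; apply: same.
  by rewrite /good maxF outF.
(* [B] exceeds the degrees of all the [c F], so the finite sum [d] carries every coefficient that
   matters. *)
pose B := (\max_(F : {set 'I_s}) msize (c F))%N.
pose d : S := \sum_(m : 'X_{1..s < B}) val m *: 'X_[m].
have dE m F : good m F -> d@_m = (c F)@_m.
  move=> goodF; have [ltm|lem] := ltnP (mdeg m) B.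
    by rewrite mcoeff_mpoly // (valE _ _ goodF).
  have -> : (c F)@_m = 0.
    apply/eqP; rewrite mcoeff_eq0; apply: msize_mdeg_ge.
    by apply: leq_trans lem; apply: leq_bigmax.
  rewrite /d linear_sum; apply: big1 => k _; rewrite /= mcoeffZ mcoeffX.
  case: eqP => [km|_]; last by rewrite mulr0.
  by have := bmdeg k; rewrite km ltnNge lem.
exists d; apply/(symbolic_power2E e_irr _) => F maxF.
have -> : a - f * d = (a - f * c F) + f * (c F - d) by ring.
apply: ideal_closedD; first exact: cP.
apply: ideal_closedM => m; rewrite mcoeff_msupp mcoeffB subr_eq0 ltnNge.
by apply: contra => outF; rewrite (dE m F) // /good maxF.
Qed.

Lemma edge_critical_cohen_macaulay : cohen_macaulay_ideal J.
Proof.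
apply: cohen_macaulay_ideal2; first exact: noetherian_mpoly.
  exact: symbolic_power2_dim.
move=> m maxm Jm.
have [F maxF Fm] :=
  symbolic_power2_sub_prime e_irr (maximal_ideal_prime maxm) Jm.
have [u [v Fuv]] := maxstable_sub2 e_irr ind2 maxF.
have [k ku kv|q monq mq] := @exists_param_maximal K s m u v maxm.
  apply: Fm; apply/mon_idealX; rewrite out_degU lt0b.
  by apply/negP => /Fuv; rewrite (negPf ku) (negPf kv).
have [m1 m2] := theta_ideal mq.
exists (theta1 s q), (theta2 s q); split=> // [a|a b].
  exact: symbolic_power2_theta1_nzd.
exact: symbolic_power2_theta2_nzd.
Qed.

End Sufficiency.

(** * From Cohen-Macaulay to edge-critical *)

Section Necessity.
Local Notation m0 := (ord_ideal K (@finset.set0 'I_s) 1).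

Lemma ord_set0E (x : S) : m0 x <-> x@_0%MM = 0.
Proof.
have out0 m : (0 < out_deg finset.set0 m)%N = (m != 0%MM).
  rewrite lt0n -mdeg_eq0 (mdeg_out_deg finset.set0) big1 ?add0n // => k.
  by rewrite inE.
split=> [mx|x0 m]; last first.
  by rewrite out0 mcoeff_msupp; apply: contraNneq => ->; rewrite x0.
apply/eqP; rewrite mcoeff_eq0; apply/negP => /mx.
by rewrite out0 eqxx.
Qed.

Lemma ord_set0_maximal : maximal_ideal m0.
Proof.
split=> [|I mI I1 x Ix]; first by case: (ord_ideal_prime K (@finset.set0 'I_s)).
apply/ord_set0E/eqP; apply: contrapT => /negP x0; apply: I1.
have Ix0 : I (x@_0%MM)%:MP.
  have -> : (x@_0%MM)%:MP = x - (x - (x@_0%MM)%:MP) by ring.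
  apply: ideal_closedB => //; apply: mI; apply/ord_set0E.
  by rewrite mcoeffB mcoeffC eqxx mulr1 subrr.
have -> : 1 = (x@_0%MM)^-1%:MP * (x@_0%MM)%:MP :> S.
  by rewrite -mpolyCM mulVf // mpolyC1.
exact: ideal_closedM.
Qed.

Lemma ord_ideal_subset (F F' : {set 'I_s}) d x : F' \subset F ->
  ord_ideal K F d x -> ord_ideal K F' d x.
Proof.
move=> /fintype.subsetP sub Fx m /Fx /leq_trans; apply.
rewrite /out_deg [leqRHS](bigID (fun k => k \notin F)) /=.
apply: leq_trans (leq_addr _ _).
rewrite [leqRHS](eq_bigl (fun k => k \notin F)) //.
move=> k; rewrite andbC; case: (boolP (k \in F)) => //= kF.
by apply: contra kF => /sub.
Qed.

Lemma ord_ideal_proper (F F' : {set 'I_s}) : F' \proper F ->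
  (ord_ideal K F 1 `<` ord_ideal K F' 1)%classic.
Proof.
move=> /properP[sub [k kF kF']].
split=> [x|sub']; first exact: ord_ideal_subset.
have /sub'/mon_idealX : ord_ideal K F' 1 'X_k.
  by apply/mon_idealX; rewrite out_degU kF'.
by rewrite out_degU kF.
Qed.

(* At a monomial of minimal degree violating [U], the coefficient of [t * x] is
   that of [x] multiplied by the constant term of [t]. *)
Lemma mon_ideal_unit_nzd (U : pred 'X_{1..s})
    (up : forall m n, U m -> U (m + n)%MM) (t x : S) :
  t@_0%MM != 0 -> mon_ideal K up (t * x) -> mon_ideal K up x.
Proof.
move=> t0 Utx m; have [n] := ubnP (mdeg m); elim: n m => // n IHn m ltm xm.
apply: contraT => nUm; pose c := t@_0%MM; pose t' := t - c%:MP.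
have t'x m1 : m1 \in msupp (t' * x) -> mdeg m1 = mdeg m -> U m1.
  move=> /msuppM_le/allpairsP[[m2 m3] [/= t'm2 xm3 ->]]; rewrite mdegD => degm.
  rewrite addmC; apply: (up); apply: IHn => //; move: ltm; rewrite -degm.
  suff: (0 < mdeg m2)%N by lia.
  rewrite lt0n mdeg_eq0; apply: contraTneq t'm2 => ->.
  by rewrite mcoeff_msupp /t' mcoeffB mcoeffC eqxx mulr1 subrr eqxx.
have t'xm : (t' * x)@_m = 0.
  by apply/eqP; rewrite mcoeff_eq0; apply: contra nUm => /t'x; apply.
case/negP: nUm; apply: (Utx m).
have -> : t * x = c%:MP * x + t' * x by rewrite /t'; ring.
by rewrite mcoeff_msupp mcoeffD t'xm addr0 mcoeffCM mulf_neq0 // -mcoeff_msupp.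
Qed.

(* The family of the [z F] is not induced by a polynomial, not even locally at
   the origin, but all its multiples by polynomials vanishing there are. *)
Lemma cohen_macaulay_edge_critical : cohen_macaulay_ideal J -> edge_critical e.
Proof.
move=> CM i j eij; apply/(critical_edgeP e_sym e_irr ind2); split=> //.
apply: contrapT => ncommon.
have [A stA cardA] := exists_stable2 ind2.
have /cards2P[u [v [uv eA]]] : #|A| == 2%N by rewrite cardA.
have euv : ~~ e u v by move/stableP: stA; apply; rewrite eA !inE eqxx ?orbT.
have maxA := maxstable_pair e_sym e_irr ind2 uv euv.
pose P n := ord_ideal K (if n is 0 then [set u; v] else
  if n is 1 then [set u] else finset.set0) 1.
have chainP : prime_chain 2 P.
  split=> [n _|[|[|//]] _]; first exact: ord_ideal_prime.
    apply: ord_ideal_proper; apply/properP; split; first exact: finset.subsetUl.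
    by exists v; rewrite !inE ?eqxx ?orbT // eq_sym.
  apply: ord_ideal_proper; apply/properP; split; first exact: finset.sub0set.
  by exists u; rewrite !inE ?eqxx.
have JP x : J x -> P 0%N x.
  by move=> /(symbolic_power2E e_irr _)/(_ _ maxA) Jx m /Jx/ltnW.
have [f [g [mf mg regf regg]]] :=
  cohen_macaulay_ideal_regular CM ord_set0_maximal chainP JP (fun x => id).
pose z F : S := if i \in F then 'X_i * 'X_j else 0.
have notin F k l : maxstable F -> e k l -> k \in F -> l \notin F.
  move=> /maxsetp/stableP stF ekl kF; apply: contraL ekl => lF; exact: stF.
have liftX k : exists h,
    forall F, maxstable F -> ord_ideal K F 2 (h - 'X_k * z F).
  have ord3 F a b c : (2 <= (a \notin F) + (b \notin F) + (c \notin F))%N ->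
      ord_ideal K F 2 ('X_a * ('X_b * 'X_c)).
    move=> le2; rewrite -!mpolyXD; apply/mon_idealX.
    by rewrite !out_degD !out_degU addnA.
  (* Here t_k t_i t_j is a lift: for [F] avoiding [i] it lies in p_F^2, because t_i occurs twice or
     [F] misses an end of the edge jk. *)
  have [ejk|ejk] := boolP ((k != j) && ((k == i) || e j k)).
    exists ('X_k * ('X_i * 'X_j)) => F maxF; rewrite /z; case: ifPn => iF.
      by rewrite subrr; apply: ideal_has0.
    rewrite mulr0 subr0; apply: ord3; rewrite iF.
    have [kj /orP[/eqP->|ekj]] := andP ejk; first by rewrite iF; lia.
    have [jF|jF] := boolP (j \in F); last by lia.
    by rewrite (notin F j k) //; lia.
  (* Otherwise [k = j], or [k] is not adjacent to [j] and therefore adjacent to [i]. An [F]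
     containing [i] then contains neither [j] nor [k], so 0 is a lift. *)
  exists 0 => F maxF; rewrite /z sub0r; case: ifPn => iF; last first.
    by rewrite mulr0 oppr0; apply: ideal_has0.
  apply: ideal_closedN; apply: ord3; rewrite iF (notin F i j) //.
  have [->|kj] := eqVneq k j; first by rewrite (notin F i j).
  move: ejk; rewrite kj /= negb_or => /andP[ki ejk].
  suff kF : k \notin F by rewrite kF.
  have [eik|eik] := boolP (e i k); first exact: notin maxF eik iF.
  by case: ncommon; exists k.
(* The elements with a lift form an ideal, and by [liftX] it contains every variable. *)
have lift y : m0 y -> exists h,
    forall F, maxstable F -> ord_ideal K F 2 (h - y * z F).
  have I0 : exists h : S,
      forall F, maxstable F -> ord_ideal K F 2 (h - 0 * z F).
    by exists 0 => F _; rewrite mul0r subr0; apply: ideal_has0.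
  have ID x1 x2 :
      (exists h, forall F, maxstable F -> ord_ideal K F 2 (h - x1 * z F)) ->
      (exists h, forall F, maxstable F -> ord_ideal K F 2 (h - x2 * z F)) ->
      exists h, forall F, maxstable F -> ord_ideal K F 2 (h - (x1 + x2) * z F).
    move=> [h1 H1] [h2 H2]; exists (h1 + h2) => F maxF.
    have -> : h1 + h2 - (x1 + x2) * z F =
        (h1 - x1 * z F) + (h2 - x2 * z F) by ring.
    by apply: ideal_closedD; [apply: H1|apply: H2].
  have IM a x1 :
      (exists h, forall F, maxstable F -> ord_ideal K F 2 (h - x1 * z F)) ->
      exists h, forall F, maxstable F -> ord_ideal K F 2 (h - (a * x1) * z F).
    move=> [h1 H1]; exists (a * h1) => F maxF.
    by rewrite -mulrA -mulrBr; apply: ideal_closedM; apply: H1.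
  apply: (@mon_ideal_min K s _ _ (Ideal I0 ID IM)) => m.
  rewrite out_deg_gt0 => /subsetPn[k]; rewrite inE -lep1mP => mk _.
  by rewrite -(submK mk) mpolyXD; apply: IM.
have [hf Hf] := lift f mf; have [hg Hg] := lift g mg.
(* Both g hf and f hg induce the family of the f g z_F, so they agree modulo [J] and regularity of
   [g] applies. *)
have [t [c [mt Jtc]]] : exists t c, ~ m0 t /\ J (t * hf - f * c).
  apply: (regg hf hg); apply/(symbolic_power2E e_irr _) => F maxF.
  have -> : g * hf - f * hg = g * (hf - f * z F) - f * (hg - g * z F) by ring.
  by apply: ideal_closedB; apply: ideal_closedM; [apply: Hf|apply: Hg].
have Ht F : maxstable F -> ord_ideal K F 2 (f * (t * z F - c)).
  move=> maxF; move/(symbolic_power2E e_irr _)/(_ F maxF): Jtc => Jtc.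
  have -> : f * (t * z F - c) = (t * hf - f * c) - t * (hf - f * z F) by ring.
  by apply: ideal_closedB => //; apply: ideal_closedM; apply: Hf.
(* [f] can be cancelled modulo [J] only, so the family is first multiplied by a variable t_k with
   [k] in [F] to lift it to [S]; afterwards the local unit [r] and t_k are cancelled modulo
   p_F^2. *)
have Hz F : maxstable F -> ord_ideal K F 2 (t * z F - c).
  move=> maxF; have [k kF] := maxstable_neq0 e_irr ind2 maxF.
  have [h Hh] := liftX k.
  have [r mr Jr] : exists2 r, ~ m0 r & J (r * (t * h - 'X_k * c)).
    apply: regf; apply/(symbolic_power2E e_irr _) => F' maxF'.
    have -> : f * (t * h - 'X_k * c) =
      f * t * (h - 'X_k * z F') + 'X_k * (f * (t * z F' - c)) by ring.
    by apply: ideal_closedD; apply: ideal_closedM; [apply: Hh|apply: Ht].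
  move/(symbolic_power2E e_irr _)/(_ F maxF): Jr => Jr.
  have : ord_ideal K F 2 (r * ('X_k * (t * z F - c))).
    have -> : r * ('X_k * (t * z F - c)) =
      r * (t * h - 'X_k * c) - r * t * (h - 'X_k * z F) by ring.
    by apply: ideal_closedB => //; apply: ideal_closedM; apply: Hh.
  move=> /mon_ideal_unit_nzd Hr.
  have {Hr} : ord_ideal K F 2 ('X_k * (t * z F - c)).
    by apply: Hr; apply/eqP => /ord_set0E.
  apply: (extended_nzd (extended_ord kF)).
  by rewrite as_polyXU eqxx monicX.
(* The coefficient at t_i t_j is visible modulo p_F^2 when [F] meets {i, j}. An [F'] containing [j]
   forces that of [c] to vanish; an [F] containing [i] then forces the constant term of [t] to
   vanish. *)
have coefz F (x : S) : maxstable F -> (i \in F) || (j \in F) ->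
    ord_ideal K F 2 x -> x@_(U_(i) + U_(j))%MM = 0.
  move=> maxF ijF Fx; apply/eqP; rewrite mcoeff_eq0; apply/negP => /Fx.
  by rewrite out_degD !out_degU; move: ijF; do 2!case: (_ \in F).
have [F maxF iF] := maxstable_exists e_irr i.
have [F' maxF' jF'] := maxstable_exists e_irr j.
have iF' : i \notin F' by apply: notin jF'; rewrite // e_sym.
have := coefz F' _ maxF' _ (Hz F' maxF'); rewrite jF' orbT => /(_ isT).
rewrite /z (negPf iF') mulr0 sub0r mcoeffN => /eqP; rewrite oppr_eq0 => /eqP c0.
have := coefz F _ maxF _ (Hz F maxF); rewrite iF => /(_ isT).
rewrite /z iF mcoeffB c0 subr0 -mpolyXD -[X in _@_X]addm0 mcoeffMX.
by move=> /ord_set0E.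
Qed.

End Necessity.

End Criterion.

(* [symmetric] must not denote the qualifier of symmetric polynomials here. *)
From mathcomp Require Import all_boot all_order all_algebra.

Theorem theorem4p19 (K : fieldType) (s : nat) (e : rel 'I_s)
    (e_sym : symmetric e) (e_irr : irreflexive e) :
  independence_number e = 2%N ->
  (cohen_macaulay_ideal (symbolic_power (edge_ideal K e) 2) <->
   edge_critical e).
Proof.
move=> ind2; split; first exact: cohen_macaulay_edge_critical.
exact: edge_critical_cohen_macaulay.
Qed.
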